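(* Let $G$ be a compact semi-simple Lie group of even rank endowed with a Samelson complex structure $I$, determined by a maximal torus $T$ (and a choice of positive roots and of a complex structure on $\mathfrak t$). Let $g$ be a left-invariant SKT $I$-Hermitian metric on $G$. Then symmetrizing $g$ by the right $T$-action on $G$, i.e. setting $$\overline g_x(u,v)=\int_T (R_h^*g)_x(u,v)\,d\nu(h),\qquad x\in G,\ u,v\in T_xG,$$ one obtains an $I$-Hermitian metric $\overline g$ which is still SKT and is also left-invariant and right $T$-invariant.
   Context: Samelson complex structure: let $T\subset G$ be a maximal torus with Lie algebra $\mathfrak t$, $\mathfrak h=\mathfrak t^{c}$, and $\mathfrak g^{c}=\mathfrak h\oplus\bigoplus_{\alpha\in\Phi}\mathfrak g_\alpha$ the root space decomposition of the complexified Lie algebra of $G$. A choice of a system of positive roots $P\subset\Phi$ and of a linear endomorphism of $\mathfrak t$ with square $-\mathrm{Id}$ determines a left-invariant complex structure $I$ on $G$: $I|_{\mathfrak t}$ is this endomorphism, and $I$ acts as multiplication by $\mathrm{i}$ on $\mathfrak g_\alpha$ and by $-\mathrm{i}$ on $\mathfrak g_{-\alpha}$ for $\alpha\in P$. $R_h$ denotes right translation by $h\in T$ on $G$ and $d\nu$ the standard (invariant) volume on the torus $T$. A metric $g$ is $I$-Hermitian if $g(I\cdot,I\cdot)=g(\cdot,\cdot)$; its fundamental form is $F(X,Y)=g(IX,Y)$, and $g$ is SKT (pluriclosed) if $\partial\overline\partial F=0$ with respect to $I$. ''Right $T$-invariant'' means invariant under $R_h$ for all $h\in T$. *)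

(* Defs.v *)
From HB Require Import structures.
From mathcomp Require Import all_boot all_order all_algebra.
From mathcomp Require Import complex.
From mathcomp Require Import all_classical all_reals all_analysis.

Set Implicit Arguments.
Unset Strict Implicit.
Unset Printing Implicit Defensive.

Import Order.TTheory GRing.Theory Num.Theory.
Import numFieldNormedType.Exports.

Local Open Scope classical_set_scope.
Local Open Scope ring_scope.

(* For U open, [Ck k U f] says that f is of class C^k on U: the partial maps
   x |-> 'd f x v are required to be C^k-1 for every fixed v, which is the usual
   notion when V is finite-dimensional (the only case used below). *)
Fixpoint Ck (R : realType) (V W : normedModType R) (k : nat)
    (U : set V) (f : V -> W) : Prop :=
  if k is k'.+1 then
    (forall x, U x -> differentiable f x) /\
    (forall v, Ck k' U (fun x => 'd f x v))
  else {within U, continuous f}.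

Definition smooth_on (R : realType) (V W : normedModType R)
    (U : set V) (f : V -> W) : Prop :=
  forall k, Ck k U f.

(* [cmap] and [cinv] are total functions; only their values on the open sets
   [cdom] and [ccod] matter. *)
Record chart (R : realType) (n : nat) (M : topologicalType) := Chart {
  cdom : set M;
  ccod : set 'rV[R]_n;
  cmap :> M -> 'rV[R]_n;
  cinv : 'rV[R]_n -> M;
  cdom_open : open cdom;
  ccod_open : open ccod;
  cmap_cod : forall x, cdom x -> ccod (cmap x);
  cinv_dom : forall p, ccod p -> cdom (cinv p);
  cmapK : forall x, cdom x -> cinv (cmap x) = x;
  cinvK : forall p, ccod p -> cmap (cinv p) = p;
  cmap_cont : {within cdom, continuous cmap};
  cinv_cont : {within ccod, continuous cinv}
}.

(* Real Lie groups of dimension n. The smooth structure is the one generated by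
   the atlas {chart_at x | x in G}; every smooth structure arises in this way,
   by choosing a chart around each point. *)
HB.mixin Record isLieGroup (R : realType) (n : nat) G
    of Group G & PointedTopological G := {
  chart_at : G -> chart R n G;
  chart_at_dom : forall x, cdom (chart_at x) x;
  lie_hausdorff : hausdorff_space G;
  lie_second_countable : @second_countable G;
  lie_transition : forall x y,
    smooth_on
      (ccod (chart_at x) `&` cinv (chart_at x) @^-1` cdom (chart_at y))
      (chart_at y \o cinv (chart_at x));
  lie_mul_cont : continuous (fun p : G * G => (p.1 * p.2)%g);
  lie_mul_smooth : forall x y z,
    smooth_on
      [set p | [/\ ccod (chart_at x) p.1, ccod (chart_at y) p.2 &
         cdom (chart_at z) (cinv (chart_at x) p.1 * cinv (chart_at y) p.2)%g]]
      (fun p => chart_at z (cinv (chart_at x) p.1 * cinv (chart_at y) p.2)%g);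
  lie_inv_cont : continuous (fun x : G => (x^-1)%g);
  lie_inv_smooth : forall x y,
    smooth_on
      [set p | ccod (chart_at x) p /\
               cdom (chart_at y) ((cinv (chart_at x) p)^-1)%g]
      (fun p => chart_at y ((cinv (chart_at x) p)^-1)%g)
}.

#[short(type="lieGroupType")]
HB.structure Definition LieGroup (R : realType) (n : nat) :=
  { G of isLieGroup R n G & Group G & PointedTopological G }.

Definition complexify_mx (R : realType) m n (A : 'M[R]_(m, n)) : 'M[R[i]]_(m, n) :=
  map_mx (real_complex R) A.

Section Tensors.
Context (R : realType) (n : nat) (G : lieGroupType R n).

(* The tangent space T_x G is 'rV[R]_n, a tangent vector at x being given by its
   coordinates in chart_at x; its complexification is 'rV[R[i]]_n. Linear maps
   act on row vectors by multiplication on the right. *)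

(* d f_x : T_x G -> T_(f x) G *)
Definition tangent_mx (f : G -> G) (x : G) : 'M[R]_n :=
  'J (chart_at (f x) \o f \o cinv (chart_at x)) (chart_at x x).

(* The differential at p of the parametrization cinv (chart_at x), from R^n to
   the tangent space at cinv (chart_at x) p; it is used to read tensor fields in
   the coordinates of the single chart chart_at x. *)
Definition frame (x : G) (p : 'rV[R]_n) : 'M[R]_n :=
  'J (chart_at (cinv (chart_at x) p) \o cinv (chart_at x)) p.

Definition tensor2 := G -> 'rV[R]_n -> 'rV[R]_n -> R.

Definition pullback (f : G -> G) (g : tensor2) : tensor2 := fun x u v =>
  g (f x) (u *m tangent_mx f x) (v *m tangent_mx f x).

Definition smooth_tensor (g : tensor2) : Prop := forall x u v,
  smooth_on (ccod (chart_at x))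
    (fun p => g (cinv (chart_at x) p) (u *m frame x p) (v *m frame x p) : R^o).

Definition riemannian (g : tensor2) : Prop :=
  [/\ forall x a u u' v, g x (a *: u + u') v = a * g x u v + g x u' v,
      forall x u v, g x u v = g x v u,
      forall x u, u != 0 -> 0 < g x u u &
      smooth_tensor g].

Definition ltrans (a x : G) : G := (a * x)%g.
Definition rtrans (a x : G) : G := (x * a)%g.

Definition left_invariant (g : tensor2) : Prop :=
  forall a x u v, pullback (ltrans a) g x u v = g x u v.

Definition right_invariant (T : set G) (g : tensor2) : Prop :=
  forall h, T h -> forall x u v, pullback (rtrans h) g x u v = g x u v.

(* Fields of endomorphisms of the tangent spaces, u |-> u *m I x. *)
Definition left_invariant_endo (I : G -> 'M[R]_n) : Prop :=
  forall a x, I x *m tangent_mx (ltrans a) x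
            = tangent_mx (ltrans a) x *m I (a * x)%g.

Definition hermitian_metric (I : G -> 'M[R]_n) (g : tensor2) : Prop :=
  forall x u v, g x (u *m I x) (v *m I x) = g x u v.

Definition fundamental_form (I : G -> 'M[R]_n) (g : tensor2) : tensor2 :=
  fun x u v => g x (u *m I x) v.

(* Complex-valued k-forms, as R[i]-multilinear forms on the complexified tangent
   spaces. Alternation and multilinearity are not part of the type: they hold
   for the fundamental form, and are preserved by the operations below. *)
Definition cform (k : nat) := G -> ('I_k -> 'rV[R[i]]_n) -> R[i].

Definition cform2_of (b : tensor2) : cform 2 := fun x w =>
  \sum_i \sum_j
    w ord0 0 i * w ord_max 0 j * (b x (delta_mx 0 i) (delta_mx 0 j))%:C%C.

(* Derivative at p of a complex-valued function along a complex vector. *)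
Definition cderive (h : 'rV[R]_n -> R[i]) (p : 'rV[R]_n) (w : 'rV[R[i]]_n) : R[i] :=
  \sum_j w 0 j *
    ('D_(delta_mx 0 j) (fun q => complex.Re (h q) : R^o) p
     +i* 'D_(delta_mx 0 j) (fun q => complex.Im (h q) : R^o) p)%C.

(* The exterior derivative at x, computed in the coordinates of chart_at x, in
   which the vectors v l are constant vector fields. *)
Definition ext_d k (w : cform k) : cform k.+1 := fun x v =>
  \sum_(l < k.+1) (-1) ^+ l *
    cderive (fun p => w (cinv (chart_at x) p)
                        (fun m => v (lift l m) *m complexify_mx (frame x p)))
            (chart_at x x) (v l).

(* The projections of the complexified tangent space onto the i- and
   (-i)-eigenspaces of I. *)
Definition proj10 (I : G -> 'M[R]_n) (x : G) : 'M[R[i]]_n :=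
  2^-1 *: (1%:M - 'i%C *: complexify_mx (I x)).
Definition proj01 (I : G -> 'M[R]_n) (x : G) : 'M[R[i]]_n :=
  2^-1 *: (1%:M + 'i%C *: complexify_mx (I x)).

(* The component of bidegree (p, k - p) of a k-form. *)
Definition type_part (I : G -> 'M[R]_n) k (p : nat) (w : cform k) : cform k :=
  fun x v => \sum_(S : {set 'I_k} | #|S| == p)
    w x (fun l => v l *m (if l \in S then proj10 I x else proj01 I x)).

(* For w of bidegree (p, k - p). *)
Definition del (I : G -> 'M[R]_n) k (p : nat) (w : cform k) : cform k.+1 :=
  type_part I p.+1 (ext_d w).
Definition delbar (I : G -> 'M[R]_n) k (p : nat) (w : cform k) : cform k.+1 :=
  type_part I p (ext_d w).

Definition skt (I : G -> 'M[R]_n) (g : tensor2) : Prop :=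
  let F := cform2_of (fundamental_form I g) in
  forall x v, del I 1 (delbar I 1 F) x v = 0.

End Tensors.

Section LieAlgebra.
Context (R : realType) (n : nat) (G : lieGroupType R n).

(* The Lie algebra of G is T_1 G with the bracket [u, v] = ad u v, where ad is
   the differential at 1 of the adjoint representation Ad. *)
Definition Ad (a : G) : 'M[R]_n :=
  tangent_mx (fun y : G => (a * y * a^-1)%g) 1%g.

Definition bracket (u v : 'rV[R]_n) : 'rV[R]_n :=
  'd (fun p : 'rV[R]_n => v *m Ad (cinv (chart_at (1%g : G)) p))
     (chart_at (1%g : G) 1%g) u.

Definition cbracket (u v : 'rV[R[i]]_n) : 'rV[R[i]]_n :=
  \sum_i \sum_j (u 0 i * v 0 j) *:
    complexify_mx (bracket (delta_mx 0 i) (delta_mx 0 j)).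

Definition lie_ideal (U : {vspace 'rV[R]_n}) : Prop :=
  forall u v, v \in U -> bracket u v \in U.

Definition derived (U : {vspace 'rV[R]_n}) : {vspace 'rV[R]_n} :=
  <<[seq bracket u v | u <- vbasis U, v <- vbasis U]>>%VS.

Definition solvable_subalgebra (U : {vspace 'rV[R]_n}) : Prop :=
  exists m, iter m derived U = 0%VS.

Definition semisimple_group : Prop :=
  forall U, lie_ideal U -> solvable_subalgebra U -> U = 0%VS.

Definition smooth_into (V : normedModType R) (f : V -> G) : Prop :=
  continuous f /\
  forall x : G, smooth_on (f @^-1` cdom (chart_at x)) (chart_at x \o f).

(* T is the image of a Lie group embedding of R^k / Z^k. *)
Definition torus (k : nat) (T : set G) : Prop :=
  exists theta : 'rV[R]_k -> G,
    [/\ smooth_into theta,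
        forall s t, theta (s + t) = (theta s * theta t)%g,
        forall s, theta s = 1%g <-> (forall j, s 0 j \is a Num.int) &
        range theta = T].

Definition maximal_torus (k : nat) (T : set G) : Prop :=
  torus k T /\ forall l T', torus l T' -> T `<=` T' -> T' = T.

Definition one_parameter_subgroup (c : R^o -> G) : Prop :=
  smooth_into c /\ forall s t, c (s + t) = (c s * c t)%g.

Definition lie_of (T : set G) : set 'rV[R]_n :=
  [set v | exists c, [/\ one_parameter_subgroup c, range c `<=` T &
                         v = derive1 (chart_at (1%g : G) \o c) 0]].

End LieAlgebra.
Arguments cbracket {R n} G u v.
Arguments semisimple_group {R n} G.

Section Roots.
Context (R : realType) (n : nat) (G : lieGroupType R n).
Variable t : {vspace 'rV[R]_n}.

Definition cartan : {vspace 'rV[R[i]]_n} :=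
  <<[seq complexify_mx X | X <- vbasis t]>>%VS.

Definition functional := 'Hom(subvs_of cartan, R[i]^o).

(* {v | [H, v] = a(H) v for all H in the Cartan subalgebra}; by linearity it is
   enough to let H range over a basis. *)
Definition root_space (a : functional) : {vspace 'rV[R[i]]_n} :=
  (\bigcap_(H <- vbasis cartan)
     passmx.leigenspace (linfun (cbracket G H)) (a (vsproj cartan H)))%VS.

Definition is_root (a : functional) : Prop :=
  a != 0 /\ root_space a != 0%VS.

Definition root_space_decomposition (Phi : seq functional) : Prop :=
  [/\ uniq Phi,
      forall a, a \in Phi <-> is_root a,
      directv (cartan + \sum_(a <- Phi) root_space a)%VS &
      (cartan + \sum_(a <- Phi) root_space a)%VS = fullv].

Definition positive_system (Phi P : seq functional) : Prop :=
  [/\ {subset P <= Phi},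
      forall a, a \in Phi -> (a \in P) (+) (- a \in P) &
      forall a b, a \in P -> b \in P -> a + b \in Phi -> a + b \in P].

Definition samelson (P : seq functional) (J : 'End(subvs_of t))
    (I : G -> 'M[R]_n) : Prop :=
  [/\ left_invariant_endo I,
      forall X : subvs_of t, vsval X *m I 1%g = vsval (J X),
      forall a v, a \in P -> v \in root_space a ->
        v *m complexify_mx (I 1%g) = 'i%C *: v &
      forall a v, a \in P -> v \in root_space (- a) ->
        v *m complexify_mx (I 1%g) = - 'i%C *: v].

End Roots.
Arguments root_space_decomposition {R n} G {t} Phi.

Section Average.
Context (R : realType) (n : nat) (G : lieGroupType R n).

Definition borel := g_sigma_algebraType (@open G).

(* nu is an invariant volume (Haar measure) of the torus T, seen on the Borel
   sets of G contained in T. It is unique up to a positive factor; the total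
   volume of T is left arbitrary. *)
Definition invariant_volume (T : set G) (nu : {measure set borel -> \bar R}) : Prop :=
  [/\ (0 < nu T)%E, (nu T < +oo)%E &
      forall (h : G) (A : set borel), T h -> measurable A -> A `<=` T ->
        nu (ltrans h @^-1` A) = nu A].

Definition symmetrization (T : set G) (nu : {measure set borel -> \bar R})
    (g : tensor2 G) : tensor2 G := fun x u v =>
  \int[nu]_(h in T) pullback (rtrans h) g x u v.

End Average.

(* Main.v *)
Require Import Defs.
From HB Require Import structures.
From mathcomp Require Import all_boot all_order all_algebra.
From mathcomp Require Import complex perm.
From mathcomp Require Import all_classical all_reals all_analysis measurable_realfun.
From mathcomp Require Import ring lra zify.

Set Implicit Arguments.
Unset Strict Implicit.
Unset Printing Implicit Defensive.

Import Order.TTheory GRing.Theory Num.Theory.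
Import numFieldNormedType.Exports.

Local Open Scope classical_set_scope.
Local Open Scope ring_scope.

(** Write R_h for the right translation by h and F for the fundamental form of g.

    The heart of the matter is that right translation by an element h of the
    torus T is holomorphic for I. Both I and the translations are determined by
    what happens at the unit, where R_h becomes Ad (h^-1) in the left-invariant
    trivialization, so Ad h has to commute with I at 1. A one-parameter subgroup
    of T through h has a generator ad X with X in the Lie algebra t of T.
    On the complexification of t the endomorphism ad X is zero, because T is
    commutative, and on each root space ad X and I are both scalar; as these
    spaces span the complexified Lie algebra, ad X commutes with I
    (samelson_ad_mx), and then so does the one-parameter group that it generates
    (one_parameter_group_comm). The same decomposition shows that I squares to -1.

    Consequently each R_h^* g is again left-invariant and I-Hermitian, its
    fundamental form is R_h^* F, and it is pluriclosed, because the exterior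
    derivative and the decomposition of forms by type are compatible with
    holomorphic maps (skt_pull_rtrans). In coordinates, the compatibility of the
    exterior derivative with smooth maps rests on the symmetry of second
    derivatives (diff_diffC, ext_der_pullback); applied to the identity map and
    two charts, it also shows that the exterior derivative does not depend on
    the chart in which it is computed, which is needed to differentiate a form
    twice.

    It remains to pass to the average. A left-invariant tensor is determined by
    its Gram matrix at 1, so the R_h^* g, with h in T, span a space of finite
    dimension. Expressing all of them through finitely many R_(h_i)^* g and
    integrating the coefficients shows that the average is a finite linear
    combination of the R_(h_i)^* g (symmetrization_rtrans_comb). All linear
    conditions, namely left invariance, compatibility with I and the pluriclosed
    condition, are therefore inherited by the average without any
    differentiation under the integral sign; smoothness holds for every
    left-invariant tensor (linv_smooth). Positivity holds because the integrand
    is continuous and positive on the compact torus, and right T-invariance is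
    the invariance of the volume of T. *)

(** * Functions of class C^k *)

Section NearDiff.
Context (R : realType) (V W : normedModType R).

Lemma near_eq_differentiable (f g : V -> W) (x : V) :
  (\near x, f x = g x) -> differentiable f x ->
  differentiable g x /\ 'd g x = 'd f x :> (V -> W).
Proof.
move=> fg df.
have fgx : f x = g x by exact: (nbhs_singleton fg).
have E : g \o shift x = cst (g x) + 'd f x +o_ (0 : V) id.
  apply/eqaddoP => _/posnumP[e]; have := diff_locally df => /eqaddoP /(_ _ (gt0 e)) /= H.
  have fg' : \forall h \near (0 : V), f (h + x) = g (h + x).
    by move: fg; rewrite (near_shift 0 x) subr0.
  near=> h.
  have -> : (g \o shift x - (cst (g x) + 'd f x)) h = (f \o shift x - (cst (f x) + 'd f x)) h.
    rewrite /= -fgx.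
    rewrite !fctE /=; congr (_ - _); symmetry; near: h; exact: fg'.
  by near: h.
have D : 'd g x = 'd f x :> (V -> W) by apply: diff_unique => //; exact: diff_continuous.
split=> //; apply/diff_locallyP; rewrite D; split=> //; exact: diff_continuous.
Unshelve. all: by end_near. Qed.

End NearDiff.

Section CkTheory.
Context (R : realType) (V : normedModType R).

Lemma Ck_weaken (W : normedModType R) k (U : set V) (f : V -> W) :
  Ck k.+1 U f -> Ck k U f.
Proof.
elim: k f => [|k IH] f [df ddf].
  apply: continuous_in_subspaceT => x /set_mem Ux.
  exact/differentiable_continuous/df.
by split=> // v; exact: IH.
Qed.

Lemma Ck_sub (W : normedModType R) k (U U' : set V) (f : V -> W) :
  U' `<=` U -> Ck k U f -> Ck k U' f.
Proof.
move=> UU; elim: k f => [|k IH] f; first exact: continuous_subspaceW.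
by case=> df ddf; split=> [x /UU /df //|v]; exact: IH (ddf v).
Qed.

Lemma open_near_eq (W : Type) (U : set V) (f g : V -> W) x :
  open U -> {in U, f =1 g} -> U x -> \near x, f x = g x.
Proof.
move=> oU fg Ux; have := open_nbhs_nbhs (conj oU Ux).
by apply: filterS => y Uy; apply: fg; exact: mem_set.
Qed.

Lemma Ck_eq (W : normedModType R) k (U : set V) (f g : V -> W) :
  open U -> {in U, f =1 g} -> Ck k U f -> Ck k U g.
Proof.
move=> oU; elim: k f g => [|k IH] f g fg.
  exact: subspace_eq_continuous.
case=> df ddf.
have H x : U x -> differentiable g x /\ 'd g x = 'd f x :> (V -> W).
  by move=> Ux; apply: near_eq_differentiable; [exact: (open_near_eq oU) | exact: df].
split=> [x /H [] //|v].
by apply: IH (ddf v) => x /set_mem /H [_ ->].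
Qed.

Lemma Ck_cst (W : normedModType R) k (U : set V) (a : W) : Ck k U (cst a).
Proof.
elim: k a => [|k IH] a; first exact/continuous_subspaceT/cst_continuous.
split=> [x _|v]; first exact: differentiable_cst.
rewrite (_ : (fun x => _) = cst 0) //; apply/funext => x.
by rewrite diff_cst.
Qed.

Lemma diffDE (W : normedModType R) (f g : V -> W) x v :
  differentiable f x -> differentiable g x ->
  'd (fun y => f y + g y) x v = 'd f x v + 'd g x v.
Proof. by move=> df dg; exact: (congr1 (fun h => h v) (diffD df dg)). Qed.

Lemma diffME (f g : V -> R^o) x v : differentiable f x -> differentiable g x ->
  'd (fun y => f y * g y : R^o) x v = f x * 'd g x v + g x * 'd f x v.
Proof.
move=> df dg.
exact: (congr1 (fun h => h v) (@diffM _ _ (f : V -> R) (g : V -> R) x df dg)).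
Qed.

Lemma diffVE (f : V -> R^o) x v : differentiable f x -> f x != 0 ->
  'd (fun y => (f y)^-1 : R^o) x v = - 1 * ((f x)^-1 * (f x)^-1 * 'd f x v).
Proof.
move=> df f0.
apply: etrans (congr1 (fun h => h v) (@diffV _ _ (f : V -> R) x df f0)) _.
by rewrite mulN1r -invfM -expr2 -scaleNr.
Qed.

Lemma CkD (W : normedModType R) k (U : set V) (f g : V -> W) :
  open U -> Ck k U f -> Ck k U g -> Ck k U (fun x => f x + g x).
Proof.
move=> oU; elim: k f g => [|k IH] f g.
  by move=> cf cg x; exact: (@continuousD _ _ (subspace U) _ _ _ (cf x) (cg x)).
move=> [df ddf] [dg ddg]; split=> [x Ux|v].
  exact: differentiableD (df _ Ux) (dg _ Ux).
apply: Ck_eq (IH _ _ (ddf v) (ddg v)) => // x /set_mem Ux.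
exact: esym (diffDE v (df _ Ux) (dg _ Ux)).
Qed.

Lemma CkM k (U : set V) (f g : V -> R^o) :
  open U -> Ck k U f -> Ck k U g -> Ck k U (fun x => f x * g x : R^o).
Proof.
move=> oU; elim: k f g => [|k IH] f g.
  by move=> cf cg x; exact: (@continuousM _ (subspace U) _ _ _ (cf x) (cg x)).
move=> Cfk Cgk; have Cf := Ck_weaken Cfk; have Cg := Ck_weaken Cgk.
case: Cfk Cgk => [df ddf] [dg ddg]; split=> [x Ux|v].
  exact: (@differentiableM _ _ f g x (df _ Ux) (dg _ Ux)).
apply: Ck_eq (CkD oU (IH _ _ Cf (ddg v)) (IH _ _ Cg (ddf v))) => // x /set_mem Ux.
exact: esym (diffME v (df _ Ux) (dg _ Ux)).
Qed.

Lemma CkV k (U : set V) (f : V -> R^o) :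
  open U -> (forall x, U x -> f x != 0) -> Ck k U f -> Ck k U (fun x => (f x)^-1 : R^o).
Proof.
move=> oU f0; elim: k => [|k IH].
  move=> cf; apply/(continuous_in_subspaceT) => x Ux.
  apply: (@continuousV _ _ _ _ (f0 _ (set_mem Ux))).
  have := cf; rewrite /= continuous_open_subspace // => /(_ _ Ux); exact.
move=> Cf; have Cfk := IH (Ck_weaken Cf); case: Cf => df ddf.
split=> [x Ux|v].
  exact: (@differentiableV _ _ f x (df _ Ux) (f0 _ Ux)).
have C1 := CkM oU (Ck_cst k U (-1 : R^o)) (CkM oU (CkM oU Cfk Cfk) (ddf v)).
apply: Ck_eq C1 => // x /set_mem Ux.
exact: esym (diffVE v (df _ Ux) (f0 _ Ux)).
Qed.

Lemma Ck_sum (W : normedModType R) k (U : set V) (J : Type) (s : seq J) (P : pred J) (f : J -> V -> W) :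
  open U -> (forall j, P j -> Ck k U (f j)) -> Ck k U (fun x => \sum_(j <- s | P j) f j x).
Proof.
move=> oU Cf; elim: s => [|j s IH].
  by apply: Ck_eq (Ck_cst k U 0) => // x _; rewrite big_nil.
case: (boolP (P j)) => Pj.
  apply: Ck_eq (CkD oU (Cf j Pj) IH) => // x _.
  by rewrite big_cons Pj.
by apply: Ck_eq IH => // x _; rewrite big_cons (negbTE Pj).
Qed.

Lemma Ck_prod k (U : set V) (J : Type) (s : seq J) (P : pred J) (f : J -> V -> R^o) :
  open U -> (forall j, P j -> Ck k U (f j)) ->
  Ck k U (fun x => \prod_(j <- s | P j) f j x : R^o).
Proof.
move=> oU Cf; elim: s => [|j s IH].
  by apply: Ck_eq (Ck_cst k U (1 : R^o)) => // x _; rewrite big_nil.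
case: (boolP (P j)) => Pj.
  apply: Ck_eq (CkM oU (Cf j Pj) IH) => // x _.
  by rewrite big_cons Pj.
by apply: Ck_eq IH => // x _; rewrite big_cons (negbTE Pj).
Qed.

End CkTheory.

Section CkComp.
Context (R : realType) (V V' W : normedModType R).

Lemma is_diff_affine (L : {linear V' -> V}) (c : V) x :
  continuous L -> is_diff x (fun y => c + L y) L.
Proof.
move=> cL; have dL := linear_differentiable x cL.
split; first exact: (differentiableD (differentiable_cst c x) dL).
apply/funext => v; apply: etrans (diffDE v (differentiable_cst c x) dL) _.
by rewrite diff_cst diff_lin // add0r.
Qed.

Lemma diff_compE (f : V -> W) (h : V' -> V) x v :
  differentiable h x -> differentiable f (h x) ->
  'd (fun y => f (h y)) x v = 'd f (h x) ('d h x v).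
Proof. by move=> dh df; exact: (congr1 (fun h => h v) (diff_comp dh df)). Qed.

(** Restricting a smooth function of two variables to a slice, or a torus
parametrization to a line through 0, is a composition with an affine map; the
chain rule then has a constant inner derivative and the class C^k is inherited
by induction on k. *)
Lemma Ck_affine k (U : set V) (f : V -> W) (L : {linear V' -> V}) (c : V) :
  open U -> continuous L -> Ck k U f ->
  Ck k [set x | U (c + L x)] (fun x => f (c + L x)).
Proof.
move=> oU cL.
have cA : continuous (fun x => c + L x).
  by move=> x; apply: differentiable_continuous; exact: (ex_diff (is_diff_def := is_diff_affine c x cL)).
have oU' : open [set x | U (c + L x)] by exact: (open_comp (fun x _ => cA x) oU).
elim: k f => [|k IH] f.
  rewrite /= !continuous_open_subspace // => cf x /set_mem /= Ux.
  by apply: (continuous_comp (cA x)); apply: cf; exact: mem_set.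
move=> [df ddf].
have dA x := is_diff_affine c x cL.
split=> [x Ux|v].
  exact: (differentiable_comp (ex_diff (is_diff_def := dA x)) (df _ Ux)).
apply: Ck_eq (IH _ (ddf (L v))) => // x /set_mem Ux.
apply/esym/(etrans (diff_compE v (ex_diff (is_diff_def := dA x)) (df _ Ux))).
by rewrite (diff_val (is_diff_def := dA x)).
Qed.

Lemma Ck_post k (U : set V) (f : V -> V') (L : {linear V' -> W}) :
  open U -> continuous L -> Ck k U f -> Ck k U (fun x => L (f x)).
Proof.
move=> oU cL; elim: k f => [|k IH] f.
  move=> cf x; exact: (continuous_comp (cf x) (cL _)).
move=> [df ddf].
split=> [x Ux|v].
  exact: (differentiable_comp (df _ Ux) (linear_differentiable _ cL)).
apply: Ck_eq (IH _ (ddf v)) => // x /set_mem Ux.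
have -> : 'd (fun x => L (f x)) x = 'd L (f x) \o 'd f x :> (V -> W).
  exact: (diff_comp (df _ Ux) (linear_differentiable _ cL)).
by rewrite diff_lin.
Qed.

End CkComp.

(** * Symmetry of second derivatives *)

Section Schwarz.
Context (R : realType) (V : normedModType R).

Lemma is_diff_line (c u : V) (t : R) :
  is_diff t (fun s : R^o => c + s *: u) (fun s : R^o => s *: u).
Proof.
have dS := @is_diff_scalel R V t u.
split; first exact: (differentiableD (differentiable_cst c t) (ex_diff (is_diff_def := dS))).
apply/funext => v.
apply: etrans (diffDE v (differentiable_cst c t) (ex_diff (is_diff_def := dS))) _.
by rewrite diff_cst (diff_val (is_diff_def := dS)) add0r.
Qed.

Lemma is_derive_line (f : V -> R^o) (c u : V) (t : R) :
  differentiable f (c + t *: u) ->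
  is_derive t (1 : R) (fun s : R => f (c + s *: u)) ('d f (c + t *: u) u).
Proof.
move=> df; have dl := is_diff_line c u t.
have dc : differentiable (fun s : R^o => f (c + s *: u)) t.
  exact: (differentiable_comp (ex_diff (is_diff_def := dl)) df).
have E := diff_compE (1 : R) (ex_diff (is_diff_def := dl)) df.
rewrite (diff_val (is_diff_def := dl)) /= scale1r in E.
split; first exact: diff_derivable.
by rewrite deriveE.
Qed.

(** Two applications of first-order information give the second difference of f
along u and v: the mean value theorem in the direction u reduces it to an
increment of D = 'd f _ u in the direction v, and the differentiability of D at
the single point x estimates this increment. *)
Lemma second_difference (U : set V) (f : V -> R^o) (x u v : V) (e : R) :
  open U -> U x -> (forall y, U y -> differentiable f y) ->
  differentiable (fun y => 'd f y u : R^o) x -> 0 < e ->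
  exists2 d : R, 0 < d & forall s : R, 0 < s -> s < d ->
   `|f (x + s *: u + s *: v) - f (x + s *: u) - f (x + s *: v) + f x
      - s * s * 'd (fun y => 'd f y u : R^o) x v| <= e * (s * s).
Proof.
move=> oU Ux df dD e0.
set D := (fun y => 'd f y u : R^o).
(* s * M bounds the norm of a *: u + b *: v when |a| and |b| are at most s. *)
pose M : R := `|u| + `|v| + 1.
have M0 : 0 < M by rewrite /M; have := normr_ge0 u; have := normr_ge0 v; lra.
have e1 : 0 < e / (2 * M) by rewrite divr_gt0 // mulr_gt0.
have : \forall h \near (0 : V), `|D (h + x) - (D x + 'd D x h)| <= e / (2 * M) * `|h|.
  by have := diff_locally dD => /eqaddoP /(_ _ e1).
move=> /nbhs_ballP [r1 /= r10 H1].
have /nbhs_ballP [r2 /= r20 H2] := open_nbhs_nbhs (conj oU Ux).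
pose d := Num.min r1 r2 / M.
exists d; first by rewrite divr_gt0 // lt_min r10.
move=> s s0 sd.
have sM : s * M < Num.min r1 r2 by rewrite -ltr_pdivlMr.
have small (a b : R) : `|a| <= s -> `|b| <= s -> `|a *: u + b *: v| <= s * M.
  move=> ha hb; apply: (le_trans (ler_normD _ _)); rewrite !normrZ.
  apply: (@le_trans _ _ (s * `|u| + s * `|v|)).
    by apply: lerD; apply: ler_wpM2r.
  by rewrite /M; lra.
have HU (a b : R) : `|a| <= s -> `|b| <= s -> U (x + (a *: u + b *: v)).
  move=> ha hb; apply: H2; rewrite -ball_normE /= opprD addrA subrr sub0r normrN.
  by apply: (le_lt_trans (small _ _ ha hb)); apply: (lt_le_trans sM); rewrite ge_min lexx orbT.
have HD (a b : R) : `|a| <= s -> `|b| <= s ->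
    `|D (x + (a *: u + b *: v)) - (D x + 'd D x (a *: u + b *: v))| <= e / 2 * s.
  move=> ha hb.
  have hr : ball 0 r1 (a *: u + b *: v).
    rewrite -ball_normE /= sub0r normrN.
    by apply: (le_lt_trans (small _ _ ha hb)); apply: (lt_le_trans sM); rewrite ge_min lexx.
  have := H1 _ hr; rewrite [_ + x]addrC => /le_trans; apply.
  have -> : e / 2 * s = e / (2 * M) * (s * M) by field; rewrite ?(gt_eqF M0) //.
  by rewrite ler_wpM2l ?small // ltW.
have ns : `|s| <= s by rewrite ger0_norm // ltW.
(* The second difference is phi s - phi 0. *)
pose phi (t : R) : R := f (x + s *: v + t *: u) - f (x + t *: u).
pose dphi (t : R) : R := D (x + s *: v + t *: u) - D (x + t *: u).
have phiD t : `|t| <= s -> is_derive t (1:R) phi (dphi t).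
  move=> ht; apply: is_deriveB.
    apply: is_derive_line; apply: df; rewrite -addrA [_ + t *: u]addrC; exact: HU.
  apply: is_derive_line; apply: df.
  by have := HU t 0 ht; rewrite scale0r addr0; apply; rewrite normr0 ltW.
have [||c cs E] := @MVT R phi dphi 0 s s0.
- move=> t; rewrite in_itv /= => /andP[t0 ts]; apply: phiD.
  by rewrite ger0_norm ltW.
- apply: continuous_in_subspaceT => t /set_mem /=; rewrite in_itv /= => /andP[t0 ts].
  have ht : `|t| <= s by rewrite ger0_norm.
  have := phiD t ht; case=> dt _; apply: differentiable_continuous.
  exact/derivable1_diffP.
move: cs; rewrite in_itv /= => /andP[c0 cs].
have hc : `|c| <= s by rewrite ger0_norm ltW.
have -> : f (x + s *: u + s *: v) - f (x + s *: u) - f (x + s *: v) + f x = dphi c * s.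
  rewrite subr0 in E; rewrite -E /phi scale0r !addr0 [x + s *: v + _]addrAC.
  by rewrite !opprD !opprK !addrA.
have K1 := HD c s hc ns; have K2 := HD c 0 hc; rewrite scale0r addr0 normr0 in K2.
have {}K2 := K2 (ltW s0).
rewrite (linearD ('d D x)) in K1.
have -> : 'd D x v = s^-1 * 'd D x (s *: v).
  by rewrite linearZ /= /GRing.scale /= mulrA mulVf ?mul1r // gt_eqF.
rewrite /dphi.
have -> : x + s *: v + c *: u = x + (c *: u + s *: v) by rewrite -addrA [s *: v + _]addrC.
move: K1 K2; set A := D _; set B := D (x + c *: u); set C := 'd D x _; set F := 'd D x _ => K1 K2.
have -> : (A - B) * s - s * s * (s^-1 * F) = s * (A - B - F).
  by field; rewrite gt_eqF.
rewrite normrM (ger0_norm (ltW s0)) mulrCA; apply: ler_wpM2l; first exact: ltW.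
have -> : A - B - F = (A - (D x + (C + F))) - (B - (D x + C)) by ring.
apply: (le_trans (ler_normB _ _)); have := lerD K1 K2; lra.
Qed.

(** By second_difference, each side is a limit of the second difference divided
by s * s, with the roles of u and v exchanged; the second difference itself is
symmetric in u and v. *)
Theorem diff_diffC (U : set V) (f : V -> R^o) (x u v : V) :
  open U -> U x -> smooth_on U f ->
  'd (fun y => 'd f y u : R^o) x v = 'd (fun y => 'd f y v : R^o) x u.
Proof.
move=> oU Ux sf.
have [df ddf] := sf 2%N.
set a := LHS; set b := RHS.
apply/eqP; rewrite -subr_eq0 -normr_eq0; apply/eqP; apply/le_anti; rewrite normr_ge0 andbT.
apply/ler_addgt0Pl => e e0; rewrite addr0.
have e2 : 0 < e / 2 by lra.
have [d1 d10 H1] := second_difference v oU Ux df ((ddf u).1 x Ux) e2.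
have [d2 d20 H2] := second_difference u oU Ux df ((ddf v).1 x Ux) e2.
pose s := Num.min d1 d2 / 2.
have m0 : 0 < Num.min d1 d2 by rewrite lt_min d10.
have s0 : 0 < s by rewrite /s; lra.
have sm : s < Num.min d1 d2 by rewrite /s; lra.
have {}H1 := H1 s s0 (lt_le_trans sm _); have {}H2 := H2 s s0 (lt_le_trans sm _).
have {}H1 := H1 ltac:(by rewrite ge_min lexx); have {}H2 := H2 ltac:(by rewrite ge_min lexx orbT).
rewrite -/a -/b in H1 H2.
rewrite [x + s *: v + _]addrAC in H2.
have ss : 0 < s * s by rewrite mulr_gt0.
rewrite -(ler_pM2r ss) -[X in _ * X]ger0_norm ?(ltW ss) // -normrM.
move: H1 H2; set P := f (_ + _ + _); set Q := f (_ + _); set Q' := f (_ + _) => H1 H2.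
have -> : (a - b) * (s * s) = (P - Q' - Q + f x - s * s * b) - (P - Q - Q' + f x - s * s * a) by ring.
apply: (le_trans (ler_normB _ _)); move: (lerD H2 H1); lra.
Qed.

End Schwarz.

(** * Smooth functions and smooth matrices *)

Section SmoothOn.
Context (R : realType) (V : normedModType R) (U : set V).
Hypothesis oU : open U.

Lemma smooth_eq (W : normedModType R) (f g : V -> W) :
  {in U, f =1 g} -> smooth_on U f -> smooth_on U g.
Proof. by move=> fg sf k; exact: Ck_eq (sf k). Qed.

Lemma smooth_cst (W : normedModType R) (a : W) : smooth_on U (fun=> a).
Proof. by move=> k; exact: Ck_cst. Qed.

Lemma smoothD (W : normedModType R) (f g : V -> W) :
  smooth_on U f -> smooth_on U g -> smooth_on U (fun x => f x + g x).
Proof. by move=> sf sg k; exact: CkD. Qed.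

Lemma smoothM (f g : V -> R^o) :
  smooth_on U f -> smooth_on U g -> smooth_on U (fun x => f x * g x : R^o).
Proof. by move=> sf sg k; exact: CkM. Qed.

Lemma smoothV (f : V -> R^o) : (forall x, U x -> f x != 0) ->
  smooth_on U f -> smooth_on U (fun x => (f x)^-1 : R^o).
Proof. by move=> f0 sf k; exact: CkV. Qed.

Lemma smooth_sum (W : normedModType R) (J : Type) (s : seq J) (P : pred J)
    (f : J -> V -> W) :
  (forall j, P j -> smooth_on U (f j)) ->
  smooth_on U (fun x => \sum_(j <- s | P j) f j x).
Proof. by move=> sf k; apply: Ck_sum => // j Pj; exact: sf. Qed.

Lemma smooth_prod (J : Type) (s : seq J) (P : pred J) (f : J -> V -> R^o) :
  (forall j, P j -> smooth_on U (f j)) ->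
  smooth_on U (fun x => \prod_(j <- s | P j) f j x : R^o).
Proof. by move=> sf k; apply: Ck_prod => // j Pj; exact: sf. Qed.

Lemma smooth_diff (W : normedModType R) (f : V -> W) v :
  smooth_on U f -> smooth_on U (fun x => 'd f x v).
Proof. by move=> sf k; have [_] := sf k.+1; exact. Qed.

Lemma smooth_differentiable (W : normedModType R) (f : V -> W) x :
  smooth_on U f -> U x -> differentiable f x.
Proof. by move=> sf Ux; have [+ _] := sf 1%N; apply. Qed.

Lemma smooth_post (V' W : normedModType R) (f : V -> V') (L : {linear V' -> W}) :
  continuous L -> smooth_on U f -> smooth_on U (fun x => L (f x)).
Proof. by move=> cL sf k; exact: Ck_post. Qed.

Lemma smooth_affine (V' W : normedModType R) (f : V -> W) (L : {linear V' -> V}) (c : V) :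
  continuous L -> smooth_on U f ->
  smooth_on [set x | U (c + L x)] (fun x => f (c + L x)).
Proof. by move=> cL sf k; exact: Ck_affine. Qed.

End SmoothOn.

Section MatrixSmooth.
Context (R : realType).

Definition coord_row n (j : 'I_n) : 'rV[R]_n -> R^o := fun v => v 0 j.
Fact coord_row_is_linear n (j : 'I_n) : linear (coord_row j).
Proof. by move=> a u v; rewrite /coord_row !mxE. Qed.
HB.instance Definition _ n (j : 'I_n) :=
  GRing.isLinear.Build R 'rV[R]_n R^o _ (coord_row j) (coord_row_is_linear j).

Lemma coord_row_continuous n (j : 'I_n) : continuous (coord_row j).
Proof. exact: coord_continuous. Qed.

Section V.
Context (V : normedModType R).

Lemma diff_coordE n (f : V -> 'rV[R]_n) x v j : differentiable f x ->
  'd (fun y => f y 0 j : R^o) x v = ('d f x v) 0 j.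
Proof.
move=> df.
have dl := linear_differentiable (f x) (coord_row_continuous (j := j)).
apply: etrans (diff_compE v df dl) _.
by rewrite diff_lin //; exact: coord_row_continuous.
Qed.

Lemma differentiable_rV m (f : V -> 'rV[R]_m) x :
  (forall j, differentiable (fun y : V => f y 0 j : R^o) x) -> differentiable f x.
Proof.
move=> df.
have -> : f = \sum_j (fun y : V => (f y 0 j : R^o) *: (delta_mx 0 j : 'rV[R]_m)).
  by apply/funext => y'; rewrite fct_sumE; exact: row_sum_delta.
by apply: differentiable_sum => j; exact: (@differentiableZl R V _ (fun y : V => f y 0 j : R) (delta_mx 0 j) x (df j)).
Qed.

Context (U : set V).
Hypothesis oU : open U.

Lemma smooth_coord n (f : V -> 'rV[R]_n) j :
  smooth_on U f -> smooth_on U (fun x => f x 0 j : R^o).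
Proof. by move=> sf; exact: (smooth_post oU (coord_row_continuous (j := j)) sf). Qed.

Definition smooth_mx m n (A : V -> 'M[R]_(m, n)) :=
  forall i j, smooth_on U (fun x => A x i j : R^o).

Lemma smooth_mulmx m n p (A : V -> 'M[R]_(m, n)) (B : V -> 'M[R]_(n, p)) :
  smooth_mx A -> smooth_mx B -> smooth_mx (fun x => A x *m B x).
Proof.
move=> sA sB i j.
have S : smooth_on U (fun x => \sum_k A x i k * B x k j : R^o).
  by apply: smooth_sum => // k _; exact: smoothM.
by apply: (smooth_eq oU _ S) => x _; rewrite mxE.
Qed.

Lemma smooth_mx_cst m n (A : 'M[R]_(m, n)) : smooth_mx (fun=> A).
Proof. by move=> i j; exact: smooth_cst. Qed.

Lemma smooth_det n (A : V -> 'M[R]_n) :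
  smooth_mx A -> smooth_on U (fun x => \det (A x) : R^o).
Proof.
move=> sA; apply: smooth_sum => // s _; apply: smoothM => //.
  exact: smooth_cst.
by apply: smooth_prod => // i _; exact: sA.
Qed.

(** Cramer's rule: the entries of the inverse are quotients of determinants. *)
Lemma smooth_invmx n (A : V -> 'M[R]_n) :
  (forall x, U x -> A x \in unitmx) -> smooth_mx A ->
  smooth_mx (fun x => invmx (A x)).
Proof.
move=> uA sA i j.
have s1 : smooth_on U (fun x => (\det (A x))^-1 : R^o).
  by apply: smoothV (smooth_det sA) => // x Ux; have := uA x Ux; rewrite unitmxE unitfE.
have s2 : smooth_on U (fun x => cofactor (A x) j i : R^o).
  apply: smoothM => //; first exact: smooth_cst.
  apply: smooth_det => k l.
  by apply: (smooth_eq oU _ (sA (lift j k) (lift i l))) => // x _; rewrite !mxE.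
apply: (smooth_eq oU _ (smoothM oU s1 s2)) => // x /set_mem /uA uAx.
by rewrite /invmx uAx !mxE.
Qed.

End V.

Lemma jacobianE n m (f : 'rV[R]_n -> 'rV[R]_m) p i j :
  ('J f p) i j = ('d f p (delta_mx 0 i)) 0 j.
Proof. by rewrite /jacobian /lin1_mx mxE. Qed.

Lemma mul_jacobian n m (f : 'rV[R]_n -> 'rV[R]_m) p u :
  u *m 'J f p = 'd f p u.
Proof. by rewrite /jacobian mul_rV_lin1. Qed.

Lemma smooth_jacobian n m (U : set 'rV[R]_n) (f : 'rV[R]_n -> 'rV[R]_m) :
  open U -> smooth_on U f -> smooth_mx U (fun p => 'J f p).
Proof.
move=> oU sf i j.
apply: (smooth_eq oU _ (smooth_coord oU j (smooth_diff (delta_mx 0 i) sf))) => //.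
by move=> p _; rewrite jacobianE.
Qed.

Lemma jacobian_comp n m p (f : 'rV[R]_m -> 'rV[R]_p) (h : 'rV[R]_n -> 'rV[R]_m) x :
  differentiable h x -> differentiable f (h x) ->
  'J (f \o h) x = 'J h x *m 'J f (h x).
Proof.
move=> dh df; apply/row_matrixP => i; rewrite !rowE mulmxA (mul_jacobian h).
apply: etrans (mul_jacobian _ _ _) _; apply: etrans (esym (mul_jacobian _ _ _)).
exact: (diff_compE _ dh df).
Qed.

Lemma jacobian_near n m (f g : 'rV[R]_n -> 'rV[R]_m) (U : set 'rV[R]_n) x :
  open U -> U x -> {in U, f =1 g} -> differentiable f x -> 'J f x = 'J g x.
Proof.
move=> oU Ux fg df.
have [_ E] := near_eq_differentiable (open_near_eq oU fg Ux) df.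
exact: (congr1 (fun h => lin1_mx h) (esym E)).
Qed.

Lemma jacobian_id n (x : 'rV[R]_n) : 'J id x = 1%:M.
Proof.
apply/row_matrixP => i; rewrite !rowE mulmx1 (mul_jacobian id).
by rewrite (diff_val (is_diff_def := is_diff_id x)).
Qed.

Section Prod.
Context (V W : normedModType R).

Definition inl_lin : V -> (V * W)%type := fun x => (x, 0).
Fact inl_lin_is_linear : linear inl_lin.
Proof. by move=> a u v; rewrite /inl_lin; congr (_, _); rewrite /= scaler0 addr0. Qed.
HB.instance Definition _ :=
  GRing.isLinear.Build R V (V * W)%type _ inl_lin inl_lin_is_linear.
Definition inr_lin : W -> (V * W)%type := fun x => (0, x).
Fact inr_lin_is_linear : linear inr_lin.
Proof. by move=> a u v; rewrite /inr_lin; congr (_, _); rewrite /= scaler0 addr0. Qed.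
HB.instance Definition _ :=
  GRing.isLinear.Build R W (V * W)%type _ inr_lin inr_lin_is_linear.

Lemma inl_lin_continuous : continuous inl_lin.
Proof. by move=> x; apply: cvg_pair; [exact: cvg_id | exact: cvg_cst]. Qed.
Lemma inr_lin_continuous : continuous inr_lin.
Proof. by move=> x; apply: cvg_pair; [exact: cvg_cst | exact: cvg_id]. Qed.

Lemma smooth_slice1 (X : normedModType R) (U : set (V * W)) (f : V * W -> X) (w : W) :
  open U -> smooth_on U f ->
  smooth_on [set x | U (x, w)] (fun x => f (x, w)).
Proof.
move=> oU sf.
have E (x : V) : (0, w) + inl_lin x = (x, w) by rewrite /inl_lin; congr (_, _); rewrite /= ?add0r ?addr0.
have := smooth_affine (L := inl_lin) oU (0, w) inl_lin_continuous sf.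
by congr smooth_on; [apply/funext => x /=; rewrite E | apply/funext => x; rewrite E].
Qed.

Lemma smooth_slice2 (X : normedModType R) (U : set (V * W)) (f : V * W -> X) (v : V) :
  open U -> smooth_on U f ->
  smooth_on [set y | U (v, y)] (fun y => f (v, y)).
Proof.
move=> oU sf.
have E (x : W) : (v, 0) + inr_lin x = (v, x) by rewrite /inr_lin; congr (_, _); rewrite /= ?add0r ?addr0.
have := smooth_affine (L := inr_lin) oU (v, 0) inr_lin_continuous sf.
by congr smooth_on; [apply/funext => x /=; rewrite E | apply/funext => x; rewrite E].
Qed.

Lemma diff_slice2 (X : normedModType R) (f : V * W -> X) (v : V) (y u : W) :
  differentiable f (v, y) ->
  'd (fun y => f (v, y)) y u = 'd f (v, y) (0, u).
Proof.
have E (x : W) : (v, 0) + inr_lin x = (v, x) by rewrite /inr_lin; congr (_, _); rewrite /= ?add0r ?addr0.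
have dA := is_diff_affine (v, 0) y inr_lin_continuous.
have K z : (v, 0) + inr_lin y = z -> differentiable f z ->
    'd (fun y => f ((v, 0) + inr_lin y)) y u = 'd f z (inr_lin u).
  move=> <- df; apply: etrans (diff_compE u (ex_diff (is_diff_def := dA)) df) _.
  by rewrite (diff_val (is_diff_def := dA)).
move=> /(K _ (E y)) <-.
by rewrite (_ : (fun y => f (v, y)) = (fun y => f ((v, 0) + inr_lin y))) //; apply/funext => x; rewrite E.
Qed.

Lemma diff_slice1 (X : normedModType R) (f : V * W -> X) (w : W) (y u : V) :
  differentiable f (y, w) ->
  'd (fun y => f (y, w)) y u = 'd f (y, w) (u, 0).
Proof.
have E (x : V) : (0, w) + inl_lin x = (x, w) by rewrite /inl_lin; congr (_, _); rewrite /= ?add0r ?addr0.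
have dA := is_diff_affine (0, w) y inl_lin_continuous.
have K z : (0, w) + inl_lin y = z -> differentiable f z ->
    'd (fun y => f ((0, w) + inl_lin y)) y u = 'd f z (inl_lin u).
  move=> <- df; apply: etrans (diff_compE u (ex_diff (is_diff_def := dA)) df) _.
  by rewrite (diff_val (is_diff_def := dA)).
move=> /(K _ (E y)) <-.
by rewrite (_ : (fun y => f (y, w)) = (fun y => f ((0, w) + inl_lin y))) //; apply/funext => x; rewrite E.
Qed.

End Prod.
End MatrixSmooth.

(** * Smooth maps of the group and their differentials *)

Section Manifold.
Context (R : realType) (n : nat) (G : lieGroupType R n).
Implicit Types (x y z a h : G) (f g : G -> G).

Local Notation c := (@chart_at R n G).
Local Notation psi x := (cinv (chart_at x)).

Lemma chartK x : psi x (c x x) = x.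
Proof. exact/cmapK/chart_at_dom. Qed.

Lemma chart_cod x : ccod (c x) (c x x).
Proof. exact/cmap_cod/chart_at_dom. Qed.

Lemma cinv_cont_at x p : ccod (c x) p -> {for p, continuous (psi x)}.
Proof.
move=> Cp; have oC := @ccod_open _ _ _ (c x).
have := @cinv_cont _ _ _ (c x); rewrite continuous_open_subspace // => /(_ p); apply.
exact: mem_set.
Qed.

Lemma cmap_cont_at x y : cdom (c x) y -> {for y, continuous (c x)}.
Proof.
move=> Cy; have oC := @cdom_open _ _ _ (c x).
have := @cmap_cont _ _ _ (c x); rewrite continuous_open_subspace // => /(_ y); apply.
exact: mem_set.
Qed.

Lemma open_cinv_preimage x (B : set G) f :
  continuous f -> open B -> open (ccod (c x) `&` (f \o psi x) @^-1` B).
Proof.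
move=> cf oB; rewrite openE => p [Cp Bp].
have oC := @ccod_open _ _ _ (c x).
apply: filterI; first exact: (open_nbhs_nbhs (conj oC Cp)).
exact: (continuous_comp (cinv_cont_at Cp) (cf _)) (open_nbhs_nbhs (conj oB Bp)).
Qed.

Definition overlap f x y : set 'rV[R]_n :=
  ccod (c x) `&` (f \o psi x) @^-1` cdom (c y).

Definition loc f x y : 'rV[R]_n -> 'rV[R]_n := c y \o f \o psi x.

(** Smoothness of f, tested in the charts of the given atlas, on the overlap
where the coordinate expression loc of f makes sense. *)
Definition smooth_self f :=
  continuous f /\ forall x y, smooth_on (overlap f x y) (loc f x y).

Lemma open_overlap f x y : smooth_self f -> open (overlap f x y).
Proof. by case=> cf _; apply: open_cinv_preimage => //; exact: cdom_open. Qed.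

Lemma smooth_self_id : smooth_self id.
Proof.
by split=> [|x y]; [move=> x; exact: cvg_id | exact: (lie_transition x y)].
Qed.

Lemma mulg_continuous (a : G) : continuous (fun x => (a * x)%g).
Proof.
move=> x.
have C : {for x, continuous (fun y : G => (a, y))}.
  by apply: cvg_pair; [exact: cvg_cst | exact: cvg_id].
exact: (continuous_comp C (lie_mul_cont (s := G) (a, x))).
Qed.

Lemma mulgr_continuous (a : G) : continuous (fun x => (x * a)%g).
Proof.
move=> x.
have C : {for x, continuous (fun y : G => (y, a))}.
  by apply: cvg_pair; [exact: cvg_id | exact: cvg_cst].
exact: (continuous_comp C (lie_mul_cont (s := G) (x, a))).
Qed.

Definition mul_dom x y z : set ('rV[R]_n * 'rV[R]_n) :=
  [set p | [/\ ccod (c x) p.1, ccod (c y) p.2 &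
              cdom (c z) (psi x p.1 * psi y p.2)%g]].

Lemma open_mul_dom x y z : open (mul_dom x y z).
Proof.
rewrite openE => -[p q] [/= Cp Cq Cz].
have cp := cinv_cont_at Cp.
have cq := cinv_cont_at Cq.
have N1 : nbhs (p, q) [set z | ccod (c x) z.1].
  exact: (@cvg_fst _ _ (nbhs p) (nbhs q) _ _ (open_nbhs_nbhs (conj (@ccod_open _ _ _ (c x)) Cp))).
have N2 : nbhs (p, q) [set z | ccod (c y) z.2].
  exact: (@cvg_snd _ _ (nbhs p) (nbhs q) _ _ (open_nbhs_nbhs (conj (@ccod_open _ _ _ (c y)) Cq))).
have N3 : nbhs (p, q) [set w | cdom (c z) (psi x w.1 * psi y w.2)%g].
  have C1 : {for (p, q), continuous (fun w : 'rV[R]_n * 'rV[R]_n => (psi x w.1, psi y w.2))}.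
    apply: cvg_pair.
      exact: (@continuous_comp _ _ _ (fun w : 'rV[R]_n * 'rV[R]_n => w.1) (psi x) (p, q) cvg_fst cp).
    exact: (@continuous_comp _ _ _ (fun w : 'rV[R]_n * 'rV[R]_n => w.2) (psi y) (p, q) cvg_snd cq).
  exact: (continuous_comp C1 (lie_mul_cont (s := G) _)) (open_nbhs_nbhs (conj (@cdom_open _ _ _ (c z)) Cz)).
by apply: filter_app N3; apply: filter_app N2; apply: filterS N1 => -[? ?] /= ? ? ?.
Qed.

Lemma smooth_ltrans a : smooth_self (ltrans a).
Proof.
split=> [|x y]; first exact: mulg_continuous.
have := smooth_slice2 (c a a) (@open_mul_dom a x y) (lie_mul_smooth a x y).
have -> : (fun y0 : 'rV[R]_n => c y (psi a (c a a, y0).1 * psi x (c a a, y0).2)%g) = loc (ltrans a) x y.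
  by apply/funext => p; rewrite /loc /ltrans /= chartK.
congr smooth_on; apply/seteqP; split=> p /=.
  by rewrite /mul_dom /overlap /ltrans /= chartK => -[].
by rewrite /mul_dom /overlap /ltrans /= chartK => -[? ?]; split=> //; exact: chart_cod.
Qed.

Lemma smooth_rtrans a : smooth_self (rtrans a).
Proof.
split=> [|x y]; first exact: mulgr_continuous.
have := smooth_slice1 (c a a) (@open_mul_dom x a y) (lie_mul_smooth x a y).
have -> : (fun y0 : 'rV[R]_n => c y (psi x (y0, c a a).1 * psi a (y0, c a a).2)%g) = loc (rtrans a) x y.
  by apply/funext => p; rewrite /loc /rtrans /= chartK.
congr smooth_on; apply/seteqP; split=> p /=.
  by rewrite /mul_dom /overlap /rtrans /= chartK => -[].
by rewrite /mul_dom /overlap /rtrans /= chartK => -[? ?]; split=> //; exact: chart_cod.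
Qed.

Lemma loc_differentiable f x y p :
  smooth_self f -> overlap f x y p -> differentiable (loc f x y) p.
Proof. by case=> _ sf Op; exact: smooth_differentiable (sf x y) Op. Qed.

(** The intermediate chart y is arbitrary, so this contains both the chain rule
for g \o f and, with f or g the identity, the effect of a change of chart. *)
Lemma jac_chain f g x y z p : smooth_self f -> smooth_self g ->
  overlap f x y p -> cdom (c z) (g (f (psi x p))) ->
  'J (loc (g \o f) x z) p
  = 'J (loc f x y) p *m 'J (loc g y z) (loc f x y p).
Proof.
move=> sf sg Op Dz.
have fp : psi y (loc f x y p) = f (psi x p) by apply: cmapK; case: Op.
have Oq : overlap g y z (loc f x y p).
  by split; [apply: cmap_cod; case: Op | rewrite /= fp].
have df := loc_differentiable sf Op; have dg := loc_differentiable sg Oq.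
rewrite -(jacobian_comp df dg); apply/esym.
apply: (jacobian_near (@open_overlap f x y sf) Op).
  by move=> q /set_mem [_ Dq]; rewrite /loc /= cmapK.
exact: differentiable_comp.
Qed.

Fact diff_key : unit. Proof. by []. Qed.

(** The differential of a map, locked: comparing two differentials by unfolding
would unfold the choice operator by which derivatives are defined. The same
holds for the locked matrices below. *)
Definition dmap : (G -> G) -> G -> 'M[R]_n := locked_with diff_key (@tangent_mx R n G).
Lemma dmapE : @tangent_mx R n G = dmap.
Proof. by rewrite /dmap unlock. Qed.

Definition frame_mx : G -> 'rV[R]_n -> 'M[R]_n := locked_with diff_key (@frame R n G).
Lemma frame_mxE : @frame R n G = frame_mx.
Proof. by rewrite /frame_mx unlock. Qed.

Definition jac : (G -> G) -> G -> G -> 'rV[R]_n -> 'M[R]_n :=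
  locked_with diff_key (fun f x y p => 'J (loc f x y) p).
Lemma jacE f x y p : 'J (loc f x y) p = jac f x y p.
Proof. by rewrite /jac unlock. Qed.

Lemma dmap_jac f x : dmap f x = jac f x (f x) (c x x).
Proof. by rewrite -dmapE -jacE. Qed.

Lemma frame_mx_jac x p : frame_mx x p = jac id x (psi x p) p.
Proof. by rewrite -frame_mxE -jacE. Qed.

Lemma jac_comp f g x y z p : smooth_self f -> smooth_self g ->
  overlap f x y p -> cdom (c z) (g (f (psi x p))) ->
  jac (g \o f) x z p = jac f x y p *m jac g y z (loc f x y p).
Proof. by rewrite -!jacE; exact: jac_chain. Qed.

Lemma loc_base f x y : loc f x y (c x x) = c y (f x).
Proof. by rewrite /loc /= chartK. Qed.

Lemma overlap_base f x : overlap f x (f x) (c x x).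
Proof. by split; [exact: chart_cod | rewrite /= chartK; exact: chart_at_dom]. Qed.

Lemma overlap_frame x p : ccod (c x) p -> overlap id x (psi x p) p.
Proof. by move=> Cp; split => //; exact: chart_at_dom. Qed.

(** The differential of g is taken at a point y that is only provably equal to
f x, so that the rule can be used at points given by different products. *)
Lemma dmap_comp f g x y : smooth_self f -> smooth_self g -> f x = y ->
  dmap (g \o f) x = dmap f x *m dmap g y.
Proof.
move=> sf sg fxy; rewrite !dmap_jac -fxy.
have Dz : cdom (c (g (f x))) (g (f (psi x (c x x)))) by rewrite chartK; exact: chart_at_dom.
by rewrite (jac_comp sf sg (overlap_base f x) Dz) loc_base.
Qed.

(** Both sides are the Jacobian matrix of f from the chart at x to the chart
attached to the point f (psi x p): on the left through the chart at y, on the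
right through the chart at psi x p. *)
Lemma jac_frame_mx f x y p : smooth_self f -> overlap f x y p ->
  jac f x y p *m frame_mx y (loc f x y p) = frame_mx x p *m dmap f (psi x p).
Proof.
move=> sf Op; have fp : psi y (loc f x y p) = f (psi x p) by apply: cmapK; case: Op.
have [Cp _] := Op.
rewrite !frame_mx_jac dmap_jac fp -(jac_comp sf smooth_self_id Op); last exact: chart_at_dom.
by rewrite -(jac_comp smooth_self_id sf (overlap_frame Cp)) //; exact: chart_at_dom.
Qed.

Lemma dmap_id x : dmap id x = 1%:M.
Proof.
rewrite dmap_jac -jacE -(jacobian_id (c x x)).
apply: (jacobian_near (@open_overlap id x x smooth_self_id)).
- exact: overlap_base.
- by move=> p /set_mem [Cp _]; rewrite /loc /= cinvK.
- by apply: loc_differentiable => //; [exact: smooth_self_id | exact: overlap_base].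
Qed.

Lemma frame_mx_base x : frame_mx x (c x x) = 1%:M.
Proof. by rewrite frame_mx_jac chartK -(dmap_id x) dmap_jac. Qed.

Lemma ltransM a b : ltrans a \o ltrans b = ltrans (a * b)%g.
Proof. by apply/funext => x; rewrite /ltrans /= mulgA. Qed.

Lemma rtransM a b : rtrans a \o rtrans b = rtrans (b * a)%g.
Proof. by apply/funext => x; rewrite /rtrans /= mulgA. Qed.

Lemma ltrans_rtrans a b : ltrans a \o rtrans b = rtrans b \o ltrans a.
Proof. by apply/funext => x; rewrite /rtrans /ltrans /= mulgA. Qed.

Lemma ltrans1 : ltrans (1%g : G) = id.
Proof. by apply/funext => x; rewrite /ltrans mul1g. Qed.

Lemma rtrans1 : rtrans (1%g : G) = id.
Proof. by apply/funext => x; rewrite /rtrans mulg1. Qed.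

Lemma dmap_ltransM a b x y : (b * x)%g = y ->
  dmap (ltrans (a * b)%g) x = dmap (ltrans b) x *m dmap (ltrans a) y.
Proof. by move=> xy; rewrite -ltransM (dmap_comp (smooth_ltrans b) (smooth_ltrans a) xy). Qed.

Lemma dmap_rtransM a b x y : (x * b)%g = y ->
  dmap (rtrans (b * a)%g) x = dmap (rtrans b) x *m dmap (rtrans a) y.
Proof. by move=> xy; rewrite -rtransM (dmap_comp (smooth_rtrans b) (smooth_rtrans a) xy). Qed.

Lemma dmap_ltransV a b x y : (b * a)%g = 1%g -> (a * x)%g = y ->
  dmap (ltrans a) x *m dmap (ltrans b) y = 1%:M.
Proof. by move=> ab /dmap_ltransM <-; rewrite ab ltrans1 dmap_id. Qed.

Lemma dmap_rtransV a b x y : (a * b)%g = 1%g -> (x * a)%g = y ->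
  dmap (rtrans a) x *m dmap (rtrans b) y = 1%:M.
Proof. by move=> ab /dmap_rtransM <-; rewrite ab rtrans1 dmap_id. Qed.

Lemma dmap_lr a b x y z : (x * b)%g = y -> (a * x)%g = z ->
  dmap (rtrans b) x *m dmap (ltrans a) y = dmap (ltrans a) x *m dmap (rtrans b) z.
Proof.
move=> xy xz; rewrite -(dmap_comp (smooth_rtrans b) (smooth_ltrans a) xy).
by rewrite -(dmap_comp (smooth_ltrans a) (smooth_rtrans b) xz) ltrans_rtrans.
Qed.

Lemma unit_ltrans a x : dmap (ltrans a) x \in unitmx.
Proof. by have /mulmx1_unit[] := dmap_ltransV (mulVg a) (erefl (a * x)%g). Qed.

Lemma unit_rtrans a x : dmap (rtrans a) x \in unitmx.
Proof. by have /mulmx1_unit[] := dmap_rtransV (mulgV a) (erefl (x * a)%g). Qed.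

Definition Ad_mx : G -> 'M[R]_n := locked_with diff_key (@Ad R n G).
Lemma Ad_mxE : @Ad R n G = Ad_mx.
Proof. by rewrite /Ad_mx unlock. Qed.

Lemma Ad_mx_dmap a : Ad_mx a = dmap (ltrans a) 1%g *m dmap (rtrans a^-1%g) a.
Proof.
rewrite -Ad_mxE /Ad dmapE -(dmap_comp (smooth_ltrans a) (smooth_rtrans a^-1%g)) //.
exact: mulg1.
Qed.

(** Since a y a^-1 * a = a y, the adjoint representation compares the two
trivializations of the tangent bundle. *)
Lemma Ad_mx_rtrans a : Ad_mx a *m dmap (rtrans a) 1%g = dmap (ltrans a) 1%g.
Proof. by rewrite Ad_mx_dmap -mulmxA (dmap_rtransV (mulVg a) (mulgV a)) mulmx1. Qed.

Lemma Ad_mxM a b : Ad_mx (a * b)%g = Ad_mx b *m Ad_mx a.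
Proof.
apply: (can_inj (mulmxK (unit_rtrans (a * b)%g 1%g))).
rewrite Ad_mx_rtrans (dmap_ltransM a (mulg1 b)) (dmap_rtransM b (mul1g a)).
rewrite -(mulmxA (Ad_mx b)) (mulmxA (Ad_mx a)) Ad_mx_rtrans.
by rewrite -(dmap_lr (mul1g b) (mulg1 a)) mulmxA Ad_mx_rtrans.
Qed.

Lemma Ad_mx1 : Ad_mx (1%g : G) = 1%:M.
Proof. by have := Ad_mx_rtrans (1%g : G); rewrite rtrans1 ltrans1 dmap_id mulmx1. Qed.

(** The left-invariant trivialization of the tangent bundle, read in the chart
at x: the row of index i is the value at p of the left-invariant vector field
that extends the i-th coordinate vector at 1. *)
Definition ltrans_mx x p : 'M[R]_n := jac (ltrans (psi x p)) 1%g x (c 1%g 1%g).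

Lemma overlap_ltrans x p : ccod (c x) p -> overlap (ltrans (psi x p)) 1%g x (c 1%g 1%g).
Proof.
move=> Cp; split; first exact: chart_cod.
by rewrite /= chartK /ltrans mulg1; exact: cinv_dom.
Qed.

Lemma loc_ltrans x p : ccod (c x) p -> loc (ltrans (psi x p)) 1%g x (c 1%g 1%g) = p.
Proof. by move=> Cp; rewrite loc_base /ltrans mulg1 cinvK. Qed.

Lemma ltrans_mx_frame x p : ccod (c x) p -> ltrans_mx x p *m frame_mx x p = dmap (ltrans (psi x p)) 1%g.
Proof.
move=> Cp; have := jac_frame_mx (smooth_ltrans (psi x p)) (overlap_ltrans Cp).
by rewrite (loc_ltrans Cp) frame_mx_base mul1mx chartK.
Qed.

Lemma ltrans_mx_unit x p : ccod (c x) p -> ltrans_mx x p \in unitmx.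
Proof.
move=> Cp; have := unit_ltrans (psi x p) 1%g.
by rewrite -(ltrans_mx_frame Cp) unitmx_mul => /andP[].
Qed.

Lemma frame_mx_unit x p : ccod (c x) p -> frame_mx x p \in unitmx.
Proof.
move=> Cp; have := unit_ltrans (psi x p) 1%g.
by rewrite -(ltrans_mx_frame Cp) unitmx_mul => /andP[].
Qed.

Lemma frame_mx_ltrans x p : ccod (c x) p ->
  frame_mx x p = invmx (ltrans_mx x p) *m dmap (ltrans (psi x p)) 1%g.
Proof. by move=> Cp; rewrite -(ltrans_mx_frame Cp) mulKmx // ltrans_mx_unit. Qed.

(** The multiplication is smooth as a function of two variables; its partial
derivative in the second one, at the unit, is therefore smooth in the first. *)
Lemma ltrans_mx_smooth x : smooth_mx (ccod (c x)) (ltrans_mx x).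
Proof.
move=> i j.
have oC := @ccod_open _ _ _ (c x).
have oD := @open_mul_dom x 1%g x.
have S := lie_mul_smooth (s := G) x 1%g x.
have S1 := smooth_slice1 (c 1%g 1%g) oD (smooth_diff (0, delta_mx 0 i) S).
have Dp p : ccod (c x) p -> mul_dom x 1%g x (p, c 1%g 1%g).
  by move=> Cp; split=> //=; [exact: chart_cod | rewrite chartK mulg1; exact: cinv_dom].
have S2 : smooth_on (ccod (c x)) _ := fun k => Ck_sub Dp (S1 k).
apply: (smooth_eq oC _ (smooth_coord oC j S2)) => p /set_mem Cp.
rewrite /ltrans_mx -jacE jacobianE.
have D : differentiable (fun q => c x (psi x q.1 * psi 1%g q.2)%g) (p, c 1%g 1%g).
  exact: smooth_differentiable S (Dp p Cp).
by have := diff_slice2 (delta_mx 0 i) D => <-.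
Qed.

End Manifold.

(** * One-parameter groups of matrices *)

Section MatrixDerivative.
Context (R : realType).

Lemma is_derive_compR (f h : R -> R) (t d e : R) :
  is_derive (h t) (1 : R) f d -> is_derive t (1 : R) h e ->
  is_derive t (1 : R) (fun s => f (h s)) (d * e).
Proof.
move=> [df <-] [dh <-].
have dfh : derivable (f \o h) t 1.
  apply/derivable1_diffP; apply: (@differentiable_comp _ _ _ _ h f t); exact/derivable1_diffP.
split; first exact: dfh.
by rewrite -[LHS]derive1E (derive1_comp dh df) !derive1E.
Qed.

Definition mx_derive m n (A : R -> 'M[R]_(m, n)) (t : R) (A' : 'M[R]_(m, n)) :=
  forall i j, is_derive t (1 : R) (fun s => A s i j : R) (A' i j).

Lemma mx_derive_cst m n (A : 'M[R]_(m, n)) t : mx_derive (fun=> A) t 0.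
Proof. by move=> i j; rewrite mxE; exact: is_derive_cst. Qed.

Lemma mx_derive_mul m n p (A : R -> 'M[R]_(m, n)) (B : R -> 'M[R]_(n, p)) t A' B' :
  mx_derive A t A' -> mx_derive B t B' ->
  mx_derive (fun s => A s *m B s) t (A' *m B t + A t *m B').
Proof.
move=> dA dB i j.
have D k := is_deriveM (dA i k) (dB k j).
have E := is_derive_sum D.
have -> : (fun s => (A s *m B s) i j) =
    \sum_(k < n) ((fun s => A s i k : R) * (fun s => B s k j : R)).
  by apply/funext => s; rewrite mxE fct_sumE.
apply: is_derive_eq E _.
rewrite !mxE -big_split /=; apply: eq_bigr => k _.
by rewrite /GRing.scale /= addrC [B t k j * _]mulrC.
Qed.

Lemma mx_derive_comp m n (A : R -> 'M[R]_(m, n)) (h : R -> R) t e A' :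
  mx_derive A (h t) A' -> is_derive t (1 : R) h e ->
  mx_derive (fun s => A (h s)) t (e *: A').
Proof.
by move=> dA dh i j; rewrite mxE mulrC; exact: (is_derive_compR (dA i j) dh).
Qed.

Lemma mx_derive_eq m n (A B : R -> 'M[R]_(m, n)) t A' :
  A =1 B -> mx_derive A t A' -> mx_derive B t A'.
Proof. by move=> /funext ->. Qed.

Lemma mx_derive0_cst m n (A : R -> 'M[R]_(m, n)) :
  (forall t, mx_derive A t 0) -> forall s t, A s = A t.
Proof.
move=> dA s t; apply/matrixP => i j.
apply: (@is_derive_0_is_cst R (fun s => A s i j)) => x.
by have := dA x i j; rewrite mxE.
Qed.

(** A t *m M *m A (- t) has derivative A t *m (D *m M - M *m D) *m A (- t) = 0,
so it keeps its value M at t = 0. *)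
Lemma one_parameter_group_comm n (A : R -> 'M[R]_n) (D M : 'M[R]_n) :
  (forall s t, A (s + t) = A s *m A t) -> A 0 = 1%:M ->
  mx_derive A 0 D -> D *m M = M *m D -> forall t, A t *m M = M *m A t.
Proof.
move=> AD A0 dA DM t.
have dAt s : mx_derive A s (A s *m D).
  have d1 : is_derive s (1 : R) (fun u : R => u - s) 1.
    have := is_deriveB (is_derive_id s (1 : R)) (is_derive_cst s s (1 : R)).
    by rewrite subr0.
  have dA' : mx_derive A (s - s) D by rewrite subrr.
  have := mx_derive_mul (mx_derive_cst (A s) s) (mx_derive_comp (h := fun u => u - s) dA' d1).
  rewrite mul0mx add0r scale1r; apply: mx_derive_eq => u.
  by rewrite -AD subrKC.
have ADC s : A s *m D = D *m A s.
  have d1 : is_derive s (1 : R) (fun u : R => u - s) 1.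
    have := is_deriveB (is_derive_id s (1 : R)) (is_derive_cst s s (1 : R)).
    by rewrite subr0.
  have dA' : mx_derive A (s - s) D by rewrite subrr.
  have E := mx_derive_mul (mx_derive_comp (h := fun u => u - s) dA' d1) (mx_derive_cst (A s) s).
  rewrite mulmx0 addr0 scale1r in E.
  have {E}E : mx_derive A s (D *m A s) by apply: mx_derive_eq E => u; rewrite -AD subrK.
  apply/matrixP => i j; have [_ <-] := dAt s i j; by have [_ <-] := E i j.
pose K s := A s *m M *m A (- s).
have dK s : mx_derive K s 0.
  have dN : is_derive s (1 : R) (fun u : R => - u) (- 1) by exact: is_deriveNid.
  have dAN := mx_derive_comp (h := fun u => - u) (dAt (- s)) dN.
  have := mx_derive_mul (mx_derive_mul (dAt s) (mx_derive_cst M s)) dAN.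
  congr mx_derive; rewrite mulmx0 addr0 scaleN1r mulmxN (ADC (- s)) -!mulmxA.
  by rewrite (mulmxA D M) DM -(mulmxA M D) subrr.
have := mx_derive0_cst dK t 0.
rewrite /K oppr0 A0 mul1mx mulmx1 => E.
by rewrite -[in RHS]E -!mulmxA -AD addNr A0 mulmx1.
Qed.

End MatrixDerivative.

(** * The adjoint representation *)

Section AdjointCalculus.
Context (R : realType) (n : nat) (G : lieGroupType R n).
Implicit Types (x y z a h : G).

Local Notation c := (@chart_at R n G).
Local Notation psi x := (cinv (chart_at x)).
Local Notation e := (c (1%g : G) 1%g).
Local Notation psi1 := (cinv (chart_at (1%g : G))).

(** The right-invariant counterpart of ltrans_mx. *)
Definition rtrans_mx x p : 'M[R]_n := jac (rtrans (psi x p)) 1%g x e.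

Lemma overlap_rtrans x p : ccod (c x) p -> overlap (rtrans (psi x p)) 1%g x e.
Proof.
move=> Cp; split; first exact: chart_cod.
by rewrite /= chartK /rtrans mul1g; exact: cinv_dom.
Qed.

Lemma rtrans_mx_frame x p : ccod (c x) p -> rtrans_mx x p *m frame_mx x p = dmap (rtrans (psi x p)) 1%g.
Proof.
move=> Cp; have := jac_frame_mx (smooth_rtrans (psi x p)) (overlap_rtrans Cp).
by rewrite loc_base /rtrans mul1g cinvK // frame_mx_base mul1mx chartK.
Qed.

Lemma rtrans_mx_unit x p : ccod (c x) p -> rtrans_mx x p \in unitmx.
Proof.
move=> Cp; have := unit_rtrans (psi x p) 1%g.
by rewrite -(rtrans_mx_frame Cp) unitmx_mul => /andP[].
Qed.

Lemma rtrans_mx_smooth x : smooth_mx (ccod (c x)) (rtrans_mx x).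
Proof.
move=> i j.
have oC := @ccod_open _ _ _ (c x).
have oD := @open_mul_dom _ _ _ 1%g x x.
have S := lie_mul_smooth (s := G) 1%g x x.
have S1 := smooth_slice2 e oD (smooth_diff (delta_mx 0 i, 0) S).
have Dp p : ccod (c x) p -> mul_dom 1%g x x (e, p).
  by move=> Cp; split=> //=; [exact: chart_cod | rewrite chartK mul1g; exact: cinv_dom].
have S2 : smooth_on (ccod (c x)) _ := fun k => Ck_sub Dp (S1 k).
apply: (smooth_eq oC _ (smooth_coord oC j S2)) => p /set_mem Cp.
rewrite /rtrans_mx -jacE jacobianE.
have D : differentiable (fun q => c x (psi 1%g q.1 * psi x q.2)%g) (e, p).
  exact: smooth_differentiable S (Dp p Cp).
by have := diff_slice1 (delta_mx 0 i) D => <-.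
Qed.

(** This writes Ad in coordinates as a quotient of two matrices that are smooth
because the multiplication is. *)
Lemma Ad_mx_chart p : ccod (c (1%g : G)) p ->
  Ad_mx (psi1 p) = ltrans_mx (1%g : G) p *m invmx (rtrans_mx (1%g : G) p).
Proof.
move=> Cp; apply: (can_inj (mulmxK (rtrans_mx_unit Cp))).
rewrite mulmxKV ?rtrans_mx_unit //; apply: (can_inj (mulmxK (frame_mx_unit Cp))).
by rewrite -mulmxA rtrans_mx_frame // ltrans_mx_frame // Ad_mx_rtrans.
Qed.

Lemma Ad_mx_smooth : smooth_mx (ccod (c (1%g : G))) (fun p => Ad_mx (psi1 p)).
Proof.
have oC := @ccod_open _ _ _ (c (1%g : G)).
move=> i j.
have S := smooth_mulmx oC (@ltrans_mx_smooth _ _ G 1%g)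
  (smooth_invmx oC (@rtrans_mx_unit 1%g) (@rtrans_mx_smooth 1%g)).
by apply: (smooth_eq oC _ (S i j)) => p /set_mem Cp; rewrite Ad_mx_chart.
Qed.

Lemma Ad_mx_differentiable i j :
  differentiable (fun p => Ad_mx (psi1 p) i j : R^o) e.
Proof. exact: smooth_differentiable (Ad_mx_smooth i j) (chart_cod 1%g). Qed.

(** The matrix of the bracket with X, acting on row vectors. *)
Definition ad_mx (X : 'rV[R]_n) : 'M[R]_n :=
  \matrix_(i, j) 'd (fun p => Ad_mx (psi1 p) i j : R^o) e X.

Lemma bracketE (X v : 'rV[R]_n) : bracket G X v = v *m ad_mx X.
Proof.
rewrite /bracket Ad_mxE.
pose g k j : 'rV[R]_n -> R^o := fun p => Ad_mx (psi1 p) k j.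
have Dg k j : differentiable (g k j) e := Ad_mx_differentiable k j.
have E j : (fun p => (v *m Ad_mx (psi1 p)) 0 j : R^o) = \sum_k (v 0 k *: g k j).
  by apply/funext => p; rewrite mxE fct_sumE.
have D j : differentiable (fun p => (v *m Ad_mx (psi1 p)) 0 j : R^o) e.
  by rewrite E; apply: differentiable_sum => k; exact: differentiableZ.
have df := differentiable_rV D.
apply/rowP => j; rewrite -(diff_coordE _ _ df) -deriveE // E derive_sum; last first.
  by move=> k; apply: derivableZ; exact: diff_derivable.
rewrite mxE; apply: eq_bigr => k _.
by rewrite deriveZ ?deriveE ?mxE //; exact: diff_derivable.
Qed.

Lemma one_parameter1 (u : R^o -> G) : one_parameter_subgroup u -> u 0 = 1%g.
Proof.
by case=> _ uD; apply: (mulgI (u 0)); rewrite -uD addr0 mulg1.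
Qed.

(** The generator of the one-parameter group Ad (u s) is ad X, where X is the
velocity of u at 0. *)
Lemma Ad_mx_one_parameter (u : R^o -> G) : one_parameter_subgroup u ->
  mx_derive (fun s => Ad_mx (u s)) 0 (ad_mx (derive1 (c 1%g \o u) 0)).
Proof.
move=> Hu; have u0 := one_parameter1 Hu.
case: Hu => -[cu su] uD i j.
set g : R^o -> 'rV[R]_n := c 1%g \o u.
pose F : 'rV[R]_n -> R^o := fun p => Ad_mx (psi1 p) i j.
have oU : open (u @^-1` cdom (c (1%g : G))).
  by apply: open_comp => [s _|]; [exact: cu | exact: cdom_open].
have U0 : (u @^-1` cdom (c (1%g : G))) 0 by rewrite /= u0; exact: chart_at_dom.
have dg : differentiable g 0 := smooth_differentiable (su 1%g) U0.
have g0 : g 0 = e by rewrite /g /= u0.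
have dF : differentiable F (g 0) by rewrite g0; exact: Ad_mx_differentiable.
have dFg : differentiable (fun s => F (g s)) 0 := differentiable_comp dg dF.
have H : is_derive (0 : R) (1 : R) (fun s : R => F (g s)) (ad_mx (derive1 g 0) i j).
  split; first exact: diff_derivable.
  rewrite deriveE // (diff_compE _ dg dF) -derive1E' // g0.
  by rewrite /ad_mx mxE.
apply: near_eq_is_derive H.
have := open_nbhs_nbhs (conj oU U0); apply: filterS => s /= Us.
by rewrite /F /g /= cmapK.
Qed.

(** Continuity at 1 comes from the chart at 1, and it is transported to h0 by
Ad h = Ad (h0^-1 h) Ad h0 (in the order of matrices acting on rows). *)
Lemma Ad_mx_continuous i j : continuous (fun h : G => Ad_mx h i j : R).
Proof.
have C1 k l : {for 1%g, continuous (fun h : G => Ad_mx h k l : R)}.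
  have cc : {for (1%g : G), continuous (c (1%g : G))}.
    by apply: cmap_cont_at; exact: chart_at_dom.
  have cF := differentiable_continuous (Ad_mx_differentiable k l).
  have CC : {for (1%g : G), continuous (fun h => Ad_mx (psi1 (c 1%g h)) k l : R)}.
    exact: (continuous_comp cc cF).
  have N : \forall h \near (1%g : G), Ad_mx (psi1 (c 1%g h)) k l = Ad_mx h k l.
    have := open_nbhs_nbhs (conj (@cdom_open _ _ _ (c (1%g : G))) (chart_at_dom 1%g)).
    by apply: filterS => h Dh; rewrite cmapK.
  rewrite /continuous_at /prop_for /= chartK in CC.
  exact: (cvg_trans (near_eq_cvg N) CC).
move=> h0.
have E h : Ad_mx h i j = \sum_k Ad_mx (h0^-1 * h)%g i k * Ad_mx h0 k j.
  by rewrite -[h in LHS]mul1g -(mulgV h0) -mulgA Ad_mxM mxE.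
rewrite (funext E).
have Ch : {for h0, continuous (fun h : G => (h0^-1 * h)%g)} by exact: mulg_continuous.
apply: cvg_big => [|k _]; first exact: add_continuous.
apply: cvgM; last exact: cvg_cst.
have C2 := C1 i k; rewrite -(mulVg h0) in C2.
exact: (continuous_comp Ch C2).
Qed.

End AdjointCalculus.

(** * The torus and the root spaces *)

Section TorusAction.
Context (R : realType) (n : nat) (G : lieGroupType R n).
Implicit Types (a h : G).

Local Notation c := (@chart_at R n G).
Local Notation psi x := (cinv (chart_at x)).

Definition line k (s : 'rV[R]_k) : R^o -> 'rV[R]_k := fun tau => tau *: s.
Fact line_is_linear k (s : 'rV[R]_k) : linear (line s).
Proof. by move=> a u v; rewrite /line scalerDl scalerA. Qed.
HB.instance Definition _ k (s : 'rV[R]_k) :=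
  GRing.isLinear.Build R R^o 'rV[R]_k _ (line s) (line_is_linear s).

Lemma line_continuous k (s : 'rV[R]_k) : continuous (line s).
Proof. by move=> x; apply: cvgZr_tmp; exact: cvg_id. Qed.

(** Straight lines through 0 in the universal covering R^k of the torus. *)
Lemma torus_one_parameter k (T : set G) h : torus k T -> T h ->
  exists u, [/\ one_parameter_subgroup u, range u `<=` T & u 1 = h].
Proof.
move=> [theta [[ct st] tD _ <-]] [s _ <-].
exists (fun tau => theta (line s tau)); split; last by rewrite /line scale1r.
- split; last by move=> x y; rewrite linearD tD.
  split=> [x|x]; first exact: (continuous_comp (@line_continuous _ s x) (ct _)).
  have oU : open (theta @^-1` cdom (c x)).
    by apply: open_comp => [y _|]; [exact: ct | exact: cdom_open].
  have := smooth_affine (L := line s) oU 0 (@line_continuous _ s) (st x).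
  have E tau : 0 + line s tau = line s tau by rewrite add0r.
  by congr smooth_on; [apply/funext => tau /=; rewrite E|apply/funext => tau /=; rewrite E].
- by move=> _ [tau _ <-]; exists (line s tau).
Qed.

Lemma torus_comm k (T : set G) a h : torus k T -> T a -> T h -> (a * h)%g = (h * a)%g.
Proof. by move=> [theta [_ tD _ <-]] [s _ <-] [s' _ <-]; rewrite -!tD addrC. Qed.

Lemma derive1_comp_dmap (f : G -> G) (u : R^o -> G) x y :
  smooth_self f -> smooth_into u -> u 0 = x -> f x = y ->
  derive1 (c y \o (f \o u)) 0 = derive1 (c x \o u) 0 *m dmap f x.
Proof.
move=> sf [cu su] ux fxy; subst y x.
set g : R^o -> 'rV[R]_n := c (u 0) \o u.
have oU : open (u @^-1` cdom (c (u 0))).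
  by apply: open_comp => [s _|]; [exact: cu | exact: cdom_open].
have U0 : (u @^-1` cdom (c (u 0))) 0 by exact: chart_at_dom.
have dg : differentiable g 0 := smooth_differentiable (su (u 0)) U0.
have dF : differentiable (loc f (u 0) (f (u 0))) (g 0).
  by apply: loc_differentiable => //; exact: overlap_base.
have dFg : differentiable (fun s => loc f (u 0) (f (u 0)) (g s)) 0 := differentiable_comp dg dF.
rewrite dmap_jac -jacE [in RHS]derive1E' //.
have -> : derive1 (c (f (u 0)) \o (f \o u)) 0
    = derive1 (fun s => loc f (u 0) (f (u 0)) (g s)) 0.
  rewrite !derive1E; apply: near_eq_derive.
  have := open_nbhs_nbhs (conj oU U0); apply: filterS => s /= Us.
  by rewrite /loc /g /= cmapK.
have E := diff_compE (1 : R^o) dg dF.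
apply: etrans (derive1E' dFg) _; apply: etrans E _.
exact: esym (mul_jacobian _ _ _).
Qed.

(** T is commutative, so right and left translation by h agree on a
one-parameter subgroup u of T; differentiating at 0 gives the invariance of its
velocity under Ad h. *)
Lemma Ad_mx_fix_lie_of k (T : set G) h X : torus k T -> T h -> lie_of T X -> X *m Ad_mx h = X.
Proof.
move=> tT Th [u [Hu uT ->]].
have u0 := one_parameter1 Hu; case: Hu => su _.
have E1 := derive1_comp_dmap (smooth_rtrans h) su u0 (mul1g h).
have E2 := derive1_comp_dmap (smooth_ltrans h) su u0 (mulg1 h).
have E : rtrans h \o u = ltrans h \o u.
  by apply/funext => s /=; apply: (torus_comm tT) => //; apply: uT; exists s.
rewrite E E2 -Ad_mx_rtrans mulmxA in E1.
by have := can_inj (mulmxK (unit_rtrans h 1%g)) E1.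
Qed.

(** Ad (u s) fixes Y for all s, so the derivative in s vanishes. *)
Lemma ad_mx_lie_of k (T : set G) X Y : torus k T -> lie_of T X -> lie_of T Y -> Y *m ad_mx G X = 0.
Proof.
move=> tT [u [Hu uT ->]] lY.
have E := mx_derive_mul (mx_derive_cst Y 0) (Ad_mx_one_parameter Hu).
rewrite mul0mx add0r in E.
have {}E : mx_derive (fun=> Y) 0 (Y *m ad_mx G (derive1 (c 1%g \o u) 0)).
  apply: mx_derive_eq E => s; apply: (Ad_mx_fix_lie_of tT) => //.
  by apply: uT; exists s.
apply/matrixP => i j; have [_ <-] := E i j; have [_ <-] := mx_derive_cst Y 0 i j.
by [].
Qed.

Lemma Ad_mx_comm_torus k (T : set G) (M : 'M[R]_n) : torus k T ->
  (forall X, lie_of T X -> ad_mx G X *m M = M *m ad_mx G X) ->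
  forall h, T h -> Ad_mx h *m M = M *m Ad_mx h.
Proof.
move=> tT HM h Th; have [u [Hu uT <-]] := torus_one_parameter tT Th.
apply: (@one_parameter_group_comm R n (fun s => Ad_mx (u s)) (ad_mx G (derive1 (c 1%g \o u) 0)) M).
- by move=> s t; rewrite addrC; case: Hu => _ ->; rewrite Ad_mxM.
- by rewrite (one_parameter1 Hu) Ad_mx1.
- exact: Ad_mx_one_parameter.
- by apply: HM; exists u.
Qed.

End TorusAction.

Section RootSpaces.
Context (R : realType) (n : nat) (G : lieGroupType R n).
Variable t : {vspace 'rV[R]_n}.
Local Notation C := (@complexify_mx R _ _).
Local Notation e := (@chart_at R n G 1%g 1%g).

Lemma complexify_mulmx m p q (A : 'M[R]_(m, p)) (B : 'M[R]_(p, q)) :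
  C (A *m B) = C A *m C B.
Proof. exact: map_mxM. Qed.

Lemma complexify_inj m p : injective (@complexify_mx R m p).
Proof.
move=> A B /matrixP AB; apply/matrixP => i j.
by have := AB i j; rewrite !mxE => /complexI.
Qed.

Lemma complexifyB m p (A B : 'M[R]_(m, p)) : C (A - B) = C A - C B.
Proof. exact: map_mxB. Qed.

Lemma complexifyD m p (A B : 'M[R]_(m, p)) : C (A + B) = C A + C B.
Proof. exact: map_mxD. Qed.

Lemma complexify1 m : C (1%:M : 'M[R]_m) = 1%:M.
Proof. exact: map_mx1. Qed.

Lemma complexify0 m p : C (0 : 'M[R]_(m, p)) = 0.
Proof. exact: map_mx0. Qed.

Fact ad_mx_is_linear : linear (@ad_mx R n G).
Proof. by move=> a X Y; apply/matrixP => i j; rewrite !mxE linearP. Qed.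
HB.instance Definition _ := GRing.isLinear.Build R 'rV[R]_n 'M[R]_n _ (@ad_mx R n G) ad_mx_is_linear.

Lemma complexify_sum m p (I : Type) (s : seq I) (a : I -> R) (A : I -> 'M[R]_(m, p)) :
  C (\sum_(i <- s) a i *: A i) = \sum_(i <- s) (a i)%:C%C *: C (A i).
Proof.
apply/matrixP => i j; rewrite summxE !mxE summxE rmorph_sum; apply: eq_bigr => k _.
by rewrite !mxE rmorphM.
Qed.

(** The complex-linear extension of ad_mx. *)
Definition cad_mx (u : 'rV[R[i]]_n) : 'M[R[i]]_n := \sum_i u 0 i *: C (ad_mx G (delta_mx 0 i)).

Fact cad_mx_is_linear : linear cad_mx.
Proof.
move=> a u v; rewrite /cad_mx scaler_sumr -big_split /=; apply: eq_bigr => i _.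
by rewrite !mxE scalerDl scalerA.
Qed.
HB.instance Definition _ := GRing.isLinear.Build R[i] 'rV[R[i]]_n 'M[R[i]]_n _ cad_mx cad_mx_is_linear.

Lemma cad_mx_complexify X : cad_mx (C X) = C (ad_mx G X).
Proof.
rewrite /cad_mx [in RHS](row_sum_delta X) linear_sum /=.
under [in RHS]eq_bigr do rewrite linearZ /=.
by rewrite complexify_sum; apply: eq_bigr => k _; rewrite mxE.
Qed.

Lemma cbracketE u v : cbracket G u v = v *m cad_mx u.
Proof.
rewrite /cbracket /cad_mx mulmx_sumr; apply: eq_bigr => i _.
rewrite -scalemxAr [in RHS](row_sum_delta v) mulmx_suml scaler_sumr.
apply: eq_bigr => j _.
rewrite -scalemxAl scalerA bracketE complexify_mulmx.
by congr (_ *: (_ *m _)); apply/rowP => k; rewrite !mxE /=; case: (k == j); rewrite ?rmorph1 ?rmorph0.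
Qed.

Lemma mem_bigcapv (K : fieldType) (vT : vectType K) (I : eqType) (s : seq I)
    (F : I -> {vspace vT}) i : i \in s -> (\bigcap_(j <- s) F j <= F i)%VS.
Proof.
elim: s => // j s IH; rewrite inE big_cons => /orP[/eqP ->|/IH si].
  exact: capvSl.
by apply: subv_trans si; exact: capvSr.
Qed.

Lemma root_space_cbracket (a : functional t) v H : v \in root_space G a ->
  H \in vbasis (cartan t) -> v *m cad_mx H = a (vsproj (cartan t) H) *: v.
Proof.
move=> va Hb.
have := subvP (mem_bigcapv (fun H => passmx.leigenspace (linfun (cbracket G H)) (a (vsproj (cartan t) H))) Hb) v va.
rewrite /passmx.leigenspace memv_ker.
have -> : cbracket G H = mulmxr (cad_mx H) by apply/funext => w; rewrite cbracketE.
rewrite !lfunE /= opp_lfunE scale_lfunE id_lfunE lfunE /= subr_eq0 => /eqP; exact.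
Qed.

Lemma root_space_ad_mx (a : functional t) v X : v \in root_space G a ->
  X \in t -> exists l, v *m C (ad_mx G X) = l *: v.
Proof.
move=> va Xt.
have CX : C X \in cartan t.
  rewrite (coord_vbasis Xt) complexify_sum; apply: memv_suml => i _.
  by apply/memvZ/memv_span/map_f/mem_nth; rewrite size_tuple.
have E : cad_mx (C X) = \sum_i coord (vbasis (cartan t)) i (C X) *: cad_mx (vbasis (cartan t))`_i.
  rewrite {1}(coord_vbasis CX) linear_sum; apply: eq_bigr => i _; exact: linearZ.
exists (\sum_i coord (vbasis (cartan t)) i (C X) * a (vsproj (cartan t) (vbasis (cartan t))`_i)).
rewrite -cad_mx_complexify E mulmx_sumr scaler_suml; apply: eq_bigr => i _.
rewrite -scalemxAr (root_space_cbracket va) ?scalerA //.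
by apply: mem_nth; rewrite size_tuple.
Qed.

(** The root space decomposition as a principle of proof: a matrix identity has
only to be tested on the torus directions and on the root spaces. *)
Lemma spanning_eq0 (Phi : seq (functional t)) (K : 'M[R[i]]_n) :
  root_space_decomposition G Phi ->
  (forall Y, Y \in t -> C Y *m K = 0) ->
  (forall a v, a \in Phi -> v \in root_space G a -> v *m K = 0) -> K = 0.
Proof.
move=> [_ _ _ full] K0 KP.
pose L := linfun (mulmxr K : 'rV_n -> 'rV_n).
have S : (cartan t + \sum_(a <- Phi) root_space G a <= lker L)%VS.
  rewrite subv_add; apply/andP; split.
    apply/span_subvP => _ /mapP[Y Yt ->]; rewrite memv_ker lfunE /= K0 //.
    exact: vbasis_mem.
  rewrite big_seq; elim/big_ind: _ => [|U V sU sV|a aP].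
  - exact: sub0v.
  - by rewrite subv_add sU.
  - by apply/subvP => v va; rewrite memv_ker lfunE /= (KP a).
apply/row_matrixP => i; rewrite rowE row0.
have := subvP S (delta_mx 0 i); rewrite full memvf => /(_ isT).
by rewrite memv_ker lfunE => /eqP.
Qed.

End RootSpaces.

(** * The Samelson complex structure *)

Section Samelson.
Context (R : realType) (n : nat) (G : lieGroupType R n).
Context (r : nat) (T : set G) (t : {vspace 'rV[R]_n}).
Context (Phi P : seq (functional t)) (J : 'End(subvs_of t)) (I : G -> 'M[R]_n).
Hypothesis hT : torus r T.
Hypothesis ht : forall X, X \in t <-> lie_of T X.
Hypothesis hPhi : root_space_decomposition G Phi.
Hypothesis hP : positive_system Phi P.
Hypothesis hJ : forall X, J (J X) = - X.
Hypothesis hI : samelson P J I.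
Local Notation C := (@complexify_mx R _ _).
Local Notation I1 := (I 1%g).

(** One of a and -a is positive, so I is multiplication by i or by -i on the
root space of a. *)
Lemma samelson_root (a : functional t) v : a \in Phi -> v \in root_space G a ->
  exists2 l : R[i], v *m C I1 = l *: v & l * l = -1.
Proof.
have [_ Hpos _] := hP; have [_ _ Ip In] := hI.
have ii : 'i%C * 'i%C = -1 :> R[i] by rewrite -expr2 sqr_i.
move=> aP va; have := Hpos a aP.
case: (boolP (a \in P)) => [aP' _|_ aP']; first by exists 'i%C => //; exact: Ip aP' va.
exists (- 'i%C); last by rewrite mulrNN.
by apply: (In _ _ aP'); rewrite opprK.
Qed.

Lemma samelson_torus Y : Y \in t -> Y *m I1 \in t /\ Y *m I1 *m I1 = - Y.
Proof.
move=> Yt; have [_ It _ _] := hI.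
pose Y' := vsproj t Y.
have EY : Y = vsval Y' by rewrite vsprojK.
rewrite EY It; split; first exact: subvsP.
by rewrite It hJ linearN.
Qed.

Lemma samelson_square1 : I1 *m I1 = - 1%:M.
Proof.
apply/eqP; rewrite -subr_eq0 opprK; apply/eqP.
apply: (@complexify_inj R); rewrite complexify0.
apply: (spanning_eq0 hPhi) => [Y Yt|a v aP va].
  have [_ E] := samelson_torus Yt.
  by rewrite -complexify_mulmx mulmxDr mulmxA E mulmx1 addNr complexify0.
have [l E ll] := samelson_root aP va.
rewrite complexifyD complexify_mulmx complexify1 mulmxDr mulmxA E mulmx1.
by rewrite -scalemxAl E scalerA ll scaleN1r addNr.
Qed.

(** On the complexified torus directions ad X vanishes and I preserves them; on
a root space both ad X and I are scalar. *)
Lemma samelson_ad_mx X : X \in t -> ad_mx G X *m I1 = I1 *m ad_mx G X.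
Proof.
move=> Xt; apply/eqP; rewrite -subr_eq0; apply/eqP.
apply: (@complexify_inj R); rewrite complexify0.
apply: (spanning_eq0 hPhi) => [Y Yt|a v aP va].
  have [IYt _] := samelson_torus Yt.
  rewrite -complexify_mulmx mulmxBr !mulmxA.
  rewrite (ad_mx_lie_of hT ((ht X).1 Xt) ((ht Y).1 Yt)).
  by rewrite (ad_mx_lie_of hT ((ht X).1 Xt) ((ht _).1 IYt)) mul0mx subr0 complexify0.
have [l E _] := samelson_root aP va.
have [m F] := root_space_ad_mx va Xt.
rewrite complexifyB !complexify_mulmx mulmxBr !mulmxA E F.
by rewrite -!scalemxAl E F !scalerA mulrC subrr.
Qed.

Lemma samelson_Ad_mx h : T h -> Ad_mx h *m I1 = I1 *m Ad_mx h.
Proof.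
apply: (Ad_mx_comm_torus hT) => X lX; apply: samelson_ad_mx; exact: (ht X).2.
Qed.

End Samelson.

(** * Left-invariant tensors *)

Section LeftInvariance.
Context (R : realType) (n : nat) (G : lieGroupType R n).
Implicit Types (x y a h : G).
Local Notation c := (@chart_at R n G).
Local Notation psi x := (cinv (chart_at x)).

(** In the left-invariant trivialization, right translation by h is the
constant matrix Ad (h^-1). *)
Lemma dmap_lr_Ad_mx x h :
  dmap (ltrans x) 1%g *m dmap (rtrans h) x = Ad_mx h^-1%g *m dmap (ltrans (x * h)%g) 1%g.
Proof.
rewrite -(dmap_lr (mul1g h) (mulg1 x)) (dmap_ltransM x (mulg1 h)) mulmxA.
congr (_ *m _); rewrite -Ad_mx_rtrans mulmxA -Ad_mxM mulgV.
by rewrite Ad_mx1 mul1mx.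
Qed.

(** Left invariance of a field of endomorphisms, with a variable for the point
a * x at which the target lies. *)
Definition linv_endo (I : G -> 'M[R]_n) :=
  forall a x y, (a * x)%g = y -> I x *m dmap (ltrans a) x = dmap (ltrans a) x *m I y.

Lemma linv_endoP I : left_invariant_endo I -> linv_endo I.
Proof. by move=> HI a x y <-; have := HI a x; rewrite dmapE. Qed.

Lemma endo_rtrans I x h : linv_endo I -> Ad_mx h^-1%g *m I 1%g = I 1%g *m Ad_mx h^-1%g ->
  I x *m dmap (rtrans h) x = dmap (rtrans h) x *m I (x * h)%g.
Proof.
move=> HI HA.
apply: (can_inj (mulKmx (unit_ltrans x 1%g))).
rewrite !mulmxA -(HI _ _ _ (mulg1 x)) dmap_lr_Ad_mx -mulmxA dmap_lr_Ad_mx.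
by rewrite mulmxA -HA -!mulmxA (HI _ _ _ (mulg1 _)).
Qed.

Lemma linv_endo_square I x : linv_endo I -> I 1%g *m I 1%g = - 1%:M -> I x *m I x = - 1%:M.
Proof.
move=> HI H1; apply: (can_inj (mulKmx (unit_ltrans x 1%g))).
rewrite mulmxA -(HI _ _ _ (mulg1 x)) -mulmxA -(HI _ _ _ (mulg1 x)) mulmxA H1.
by rewrite mulNmx mul1mx mulmxN mulmx1.
Qed.

(** The field I in the coordinates of the chart at x. It is written through the
left-invariant trivialization, which makes its smoothness visible; endo_repE
identifies it. *)
Definition endo_rep (I : G -> 'M[R]_n) x p : 'M[R]_n :=
  invmx (ltrans_mx x p) *m I 1%g *m ltrans_mx x p.

Lemma endo_repE I x p : linv_endo I -> ccod (c x) p ->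
  endo_rep I x p *m frame_mx x p = frame_mx x p *m I (psi x p).
Proof.
move=> HI Cp.
rewrite /endo_rep -(mulmxA (_ *m _)) ltrans_mx_frame // frame_mx_ltrans //.
by rewrite -[in RHS]mulmxA -(HI _ _ _ (mulg1 _)) mulmxA.
Qed.

Lemma smooth_endo_rep I x : smooth_mx (ccod (c x)) (endo_rep I x).
Proof.
have oC := @ccod_open _ _ _ (c x).
apply: smooth_mulmx => //; last exact: ltrans_mx_smooth.
apply: smooth_mulmx => //; last exact: smooth_mx_cst.
by apply: smooth_invmx => //; [exact: ltrans_mx_unit | exact: ltrans_mx_smooth].
Qed.

Definition pull (f : G -> G) (g : tensor2 G) : tensor2 G := fun x u v =>
  g (f x) (u *m dmap f x) (v *m dmap f x).

Lemma pullE : @pullback R n G = pull.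
Proof. by rewrite /pullback dmapE. Qed.

Definition bilin (g : tensor2 G) :=
  (forall x (a : R) u u' v, g x (a *: u + u') v = a * g x u v + g x u' v) /\
  (forall x (a : R) u u' v, g x v (a *: u + u') = a * g x v u + g x v u').

Definition linv (g : tensor2 G) := forall a x, pull (ltrans a) g x = g x.

Definition gram (g : tensor2 G) : 'M[R]_n :=
  \matrix_(i, j) g 1%g (delta_mx 0 i) (delta_mx 0 j).

Lemma bilin_sum g x (u v : 'rV[R]_n) : bilin g ->
  g x u v = \sum_i \sum_j u 0 i * v 0 j * g x (delta_mx 0 i) (delta_mx 0 j).
Proof.
move=> [gl gr].
have gl0 w : g x 0 w = 0.
  by have := gl x 1 0 0 w; rewrite scaler0 addr0 mul1r => /eqP; rewrite -subr_eq0 opprD addrA subrr sub0r oppr_eq0 => /eqP.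
have gr0 w : g x w 0 = 0.
  by have := gr x 1 0 0 w; rewrite scaler0 addr0 mul1r => /eqP; rewrite -subr_eq0 opprD addrA subrr sub0r oppr_eq0 => /eqP.
have gls (I : Type) (s : seq I) (b : I -> R) (w : I -> 'rV[R]_n) z :
    g x (\sum_(i <- s) b i *: w i) z = \sum_(i <- s) b i * g x (w i) z.
  by elim: s => [|i s IH]; rewrite ?big_nil ?gl0 // !big_cons gl IH.
have grs (I : Type) (s : seq I) (b : I -> R) (w : I -> 'rV[R]_n) z :
    g x z (\sum_(i <- s) b i *: w i) = \sum_(i <- s) b i * g x z (w i).
  by elim: s => [|i s IH]; rewrite ?big_nil ?gr0 // !big_cons gr IH.
rewrite {1}(row_sum_delta u) gls; apply: eq_bigr => i _.
rewrite {1}(row_sum_delta v) grs mulr_sumr; apply: eq_bigr => j _.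
by rewrite mulrA.
Qed.

Lemma gramE g u v : bilin g -> g 1%g u v = (u *m gram g *m v^T) 0 0.
Proof.
move=> bg; rewrite (bilin_sum _ _ _ bg) -mulmxA mxE; apply: eq_bigr => i _.
rewrite mxE mulr_sumr; apply: eq_bigr => j _.
by rewrite !mxE; ring.
Qed.

Lemma linv_base g x u v : linv g -> g x u v
  = g 1%g (u *m invmx (dmap (ltrans x) 1%g)) (v *m invmx (dmap (ltrans x) 1%g)).
Proof.
move=> lg; rewrite -[in RHS](lg x 1%g) /pull /ltrans mulg1.
by rewrite !mulmxKV // unit_ltrans.
Qed.

Lemma linv_rep g x p u v : linv g -> ccod (c x) p ->
  g (psi x p) (u *m frame_mx x p) (v *m frame_mx x p)
  = g 1%g (u *m invmx (ltrans_mx x p)) (v *m invmx (ltrans_mx x p)).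
Proof.
by move=> lg Cp; rewrite linv_base // frame_mx_ltrans // !mulmxA !mulmxK // unit_ltrans.
Qed.

(** In the left-invariant trivialization the tensor has constant coefficients,
and the trivialization is smooth. *)
Lemma linv_smooth g : bilin g -> linv g -> smooth_tensor g.
Proof.
move=> bg lg x u v; rewrite frame_mxE.
have oC := @ccod_open _ _ _ (c x).
have Si : smooth_mx (ccod (c x)) (fun p => invmx (ltrans_mx x p)).
  by apply: smooth_invmx => //; [exact: ltrans_mx_unit | exact: ltrans_mx_smooth].
have Su w : smooth_mx (ccod (c x)) (fun p => w *m invmx (ltrans_mx x p) : 'rV[R]_n).
  by apply: smooth_mulmx => //; exact: smooth_mx_cst.
have S : smooth_on (ccod (c x)) (fun p =>
   \sum_i \sum_j (u *m invmx (ltrans_mx x p)) 0 i * (v *m invmx (ltrans_mx x p)) 0 j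
       * g 1%g (delta_mx 0 i) (delta_mx 0 j) : R^o).
  apply: smooth_sum => // i _; apply: smooth_sum => // j _.
  apply: smoothM => //; last exact: smooth_cst.
  by apply: smoothM => //; exact: Su.
apply: (smooth_eq oC _ S) => p /set_mem Cp.
by rewrite linv_rep // [RHS]bilin_sum.
Qed.

Lemma pull_rtrans1 g h u v : linv g -> pull (rtrans h) g 1%g u v
  = g 1%g (u *m Ad_mx h^-1%g) (v *m Ad_mx h^-1%g).
Proof.
move=> lg; rewrite -(lg h 1%g) /pull /rtrans /ltrans mul1g mulg1.
have E : Ad_mx h^-1%g *m dmap (ltrans h) 1%g = dmap (rtrans h) 1%g.
  by rewrite -Ad_mx_rtrans mulmxA -Ad_mxM mulgV Ad_mx1 mul1mx.
by rewrite -!mulmxA E.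
Qed.

Lemma linv_pull_rtrans g h : linv g -> linv (pull (rtrans h) g).
Proof.
move=> lg a x; apply/funext => u; apply/funext => v.
rewrite /pull -(lg a (rtrans h x)) /pull.
have E : dmap (ltrans a) x *m dmap (rtrans h) (ltrans a x)
    = dmap (rtrans h) x *m dmap (ltrans a) (rtrans h x).
  by rewrite (@dmap_lr _ _ _ a h x (x * h)%g (a * x)%g).
have E2 : rtrans h (ltrans a x) = ltrans a (rtrans h x) by rewrite /rtrans /ltrans mulgA.
by rewrite -!mulmxA E E2.
Qed.

Lemma bilin_pull g f : bilin g -> bilin (pull f g).
Proof.
move=> [gl gr]; split=> x a u u' v; rewrite /pull mulmxDl -scalemxAl; by [rewrite gl|rewrite gr].
Qed.

End LeftInvariance.

(** * Complex-valued functions of real variables *)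

Section ComplexAlgebra.
Context (R : realType).

(** The two components of the derivative of a product h * k, where a + i b and
c + i d are the derivatives of h and k, and where the constant factor -1 of the
real part is differentiated as a function. *)
Lemma complex_leibniz (h k : R[i]) (a b c d : R) :
  let r := @complex.Re R in let m := @complex.Im R in
  ((r h * c + r k * a + (-1 * (m h * d + m k * b) + m h * m k * 0))
   +i* (r h * d + m k * a + (m h * c + r k * b)))%C
  = (a +i* b)%C * k + h * (c +i* d)%C.
Proof.
case: h k => [h1 h2] [k1 k2] /=.
by apply/eqP; rewrite eq_complex /=; apply/andP; split; apply/eqP; ring.
Qed.

Lemma complex_sum (I : Type) (s : seq I) (x a b : I -> R) :
  ((\sum_(k <- s) x k * a k) +i* (\sum_(k <- s) x k * b k))%C
  = \sum_(k <- s) (x k)%:C%C * (a k +i* b k)%C.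
Proof.
elim: s => [|k s IH]; rewrite ?big_nil // !big_cons -IH.
by apply/eqP; rewrite eq_complex /=; apply/andP; split; apply/eqP; ring.
Qed.

End ComplexAlgebra.

Section ComplexCalculus.
Context (R : realType) (n : nat).
Local Notation V := 'rV[R]_n.
Local Notation cV := 'rV[R[i]]_n.
Local Notation C := (@complexify_mx R _ _).
Implicit Types (h k : V -> R[i]) (p : V) (u w : cV).

Definition reC h : V -> R^o := fun q => complex.Re (h q).
Definition imC h : V -> R^o := fun q => complex.Im (h q).

Definition cdiff h p := differentiable (reC h) p /\ differentiable (imC h) p.

Definition csmooth (U : set V) h := smooth_on U (reC h) /\ smooth_on U (imC h).

Definition cdiff_val h p (u : V) : R[i] := ('d (reC h) p u +i* 'd (imC h) p u)%C.

Lemma cderiveE h p w : cdiff h p ->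
  cderive h p w = \sum_j w 0 j * cdiff_val h p (delta_mx 0 j).
Proof. by move=> [d1 d2]; apply: eq_bigr => j _; rewrite !deriveE. Qed.

Lemma csmooth_cdiff U h p : csmooth U h -> U p -> cdiff h p.
Proof. by move=> [s1 s2] Up; split; exact: smooth_differentiable Up. Qed.

Lemma cderive_dirD h p (a : R[i]) u w :
  cderive h p (a *: u + w) = a * cderive h p u + cderive h p w.
Proof.
rewrite /cderive mulr_sumr -big_split /=; apply: eq_bigr => j _.
by rewrite !mxE mulrDl mulrA.
Qed.

Lemma cderive_near (U : set V) h k p w :
  open U -> U p -> {in U, h =1 k} -> cderive h p w = cderive k p w.
Proof.
move=> oU Up hk; apply: eq_bigr => j _.
congr (_ * (_ +i* _)%C); apply: near_eq_derive.
  by apply: (open_near_eq oU) => // q Uq; rewrite hk.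
by apply: (open_near_eq oU) => // q Uq; rewrite hk.
Qed.

Lemma csmooth_eq (U : set V) h k : open U -> {in U, h =1 k} -> csmooth U h -> csmooth U k.
Proof.
move=> oU hk [s1 s2].
split; [apply: (smooth_eq oU _ s1)|apply: (smooth_eq oU _ s2)] => q Uq;
  by rewrite /reC /imC hk.
Qed.

Lemma cdiff_cst (a : R[i]) p : cdiff (fun=> a) p.
Proof. by split; exact: differentiable_cst. Qed.

Lemma csmooth_cst (U : set V) (a : R[i]) : csmooth U (fun=> a).
Proof. by split; exact: smooth_cst. Qed.

Lemma cderive_cst (a : R[i]) p w : cderive (fun=> a) p w = 0.
Proof.
rewrite (cderiveE _ (cdiff_cst a p)); apply: big1 => j _; rewrite /cdiff_val.
have c0 (b : R^o) : 'd (fun=> b) p (delta_mx 0 j : V) = 0 := congr1 (fun F => F _) (diff_cst b p).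
by rewrite (congr2 (fun a b => (a +i* b)%C) (c0 _) (c0 _)) mulr0.
Qed.

Lemma reCD h k : reC (fun q => h q + k q) = (fun q => reC h q + reC k q).
Proof. by apply/funext => q; rewrite /reC; case: (h q) (k q) => [? ?] [? ?]. Qed.

Lemma imCD h k : imC (fun q => h q + k q) = (fun q => imC h q + imC k q).
Proof. by apply/funext => q; rewrite /imC; case: (h q) (k q) => [? ?] [? ?]. Qed.

Lemma cdiffD h k p : cdiff h p -> cdiff k p -> cdiff (fun q => h q + k q) p.
Proof.
by move=> [h1 h2] [k1 k2]; split; rewrite ?reCD ?imCD; exact: differentiableD.
Qed.

Lemma csmoothD (U : set V) h k : open U -> csmooth U h -> csmooth U k ->
  csmooth U (fun q => h q + k q).
Proof.
by move=> oU [h1 h2] [k1 k2]; split; rewrite ?reCD ?imCD; exact: smoothD.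
Qed.

Lemma reCM h k : reC (fun q => h q * k q)
  = (fun q => reC h q * reC k q + (-1) * (imC h q * imC k q) : R^o).
Proof. by apply/funext => q; rewrite /reC /imC; case: (h q) (k q) => [? ?] [? ?] /=; ring. Qed.

Lemma imCM h k : imC (fun q => h q * k q)
  = (fun q => reC h q * imC k q + imC h q * reC k q : R^o).
Proof. by apply/funext => q; rewrite /reC /imC; case: (h q) (k q) => [? ?] [? ?] /=; ring. Qed.

Lemma csmoothM (U : set V) h k : open U -> csmooth U h -> csmooth U k ->
  csmooth U (fun q => h q * k q).
Proof.
move=> oU [h1 h2] [k1 k2]; split.
  rewrite reCM; apply: smoothD => //; first exact: smoothM.
  by apply: smoothM => //; [exact: smooth_cst | exact: smoothM].
by rewrite imCM; apply: smoothD => //; exact: smoothM.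
Qed.

Lemma differentiable_mul (f g : V -> R^o) p : differentiable f p -> differentiable g p ->
  differentiable (fun q => f q * g q : R^o) p.
Proof. by move=> df dg; exact: (@differentiableM _ _ f g p df dg). Qed.

Lemma cdiffM h k p : cdiff h p -> cdiff k p -> cdiff (fun q => h q * k q) p.
Proof.
move=> [h1 h2] [k1 k2]; split.
  rewrite reCM; apply: differentiableD; first exact: differentiable_mul.
  by apply: differentiable_mul; [exact: differentiable_cst | exact: differentiable_mul].
by rewrite imCM; apply: differentiableD; exact: differentiable_mul.
Qed.

Lemma cdiff_valD h k p v : cdiff h p -> cdiff k p ->
  cdiff_val (fun q => h q + k q) p v = cdiff_val h p v + cdiff_val k p v.
Proof.
move=> [h1 h2] [k1 k2]; rewrite {1}/cdiff_val reCD imCD.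
exact: (congr2 (fun a b => (a +i* b)%C) (diffDE v h1 k1) (diffDE v h2 k2)).
Qed.

Lemma cdiff_valM h k p v : cdiff h p -> cdiff k p ->
  cdiff_val (fun q => h q * k q) p v = cdiff_val h p v * k p + h p * cdiff_val k p v.
Proof.
move=> [h1 h2] [k1 k2]; rewrite {1}/cdiff_val reCM imCM.
have d3 := differentiable_mul h2 k2; have dc := differentiable_cst (-1 : R^o) p.
have c0 : 'd (fun=> -1 : R^o) p v = 0 := congr1 (fun F => F v) (diff_cst (-1 : R^o) p).
have E1 := etrans (diffDE v (differentiable_mul h1 k1) (differentiable_mul dc d3))
  (congr2 +%R (diffME v h1 k1) (etrans (diffME v dc d3)
     (congr2 (fun a b => -1 * a + _ * b) (diffME v h2 k2) c0))).
have E2 := etrans (diffDE v (differentiable_mul h1 k2) (differentiable_mul h2 k1))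
  (congr2 +%R (diffME v h1 k2) (diffME v h2 k1)).
apply: etrans (congr2 (fun a b => (a +i* b)%C) E1 E2) _.
exact: complex_leibniz.
Qed.

Lemma cderiveD h k p w : cdiff h p -> cdiff k p ->
  cderive (fun q => h q + k q) p w = cderive h p w + cderive k p w.
Proof.
move=> dh dk; rewrite !cderiveE //; last exact: cdiffD.
by rewrite -big_split; apply: eq_bigr => j _; rewrite cdiff_valD // mulrDr.
Qed.

Lemma cderiveM h k p w : cdiff h p -> cdiff k p ->
  cderive (fun q => h q * k q) p w = cderive h p w * k p + h p * cderive k p w.
Proof.
move=> dh dk; rewrite !cderiveE //; last exact: cdiffM.
rewrite mulr_suml mulr_sumr -big_split; apply: eq_bigr => j _; rewrite cdiff_valM //.
by rewrite mulrDr mulrA mulrCA.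
Qed.

Lemma cderiveZ h p w a : cdiff h p -> cderive (fun q => a * h q) p w = a * cderive h p w.
Proof.
by move=> dh; rewrite (cderiveM _ (cdiff_cst a p) dh) cderive_cst mul0r add0r.
Qed.

Lemma cdiff_sum (I : Type) (s : seq I) (P : pred I) (h : I -> V -> R[i]) p :
  (forall i, P i -> cdiff (h i) p) -> cdiff (fun q => \sum_(i <- s | P i) h i q) p.
Proof.
move=> dh; elim: s => [|i s IH].
  by under eq_fun do rewrite big_nil; exact: cdiff_cst.
under eq_fun do rewrite big_cons.
by case: (boolP (P i)) => // /dh di; exact: cdiffD.
Qed.

Lemma csmooth_sum (U : set V) (I : Type) (s : seq I) (P : pred I) (h : I -> V -> R[i]) :
  open U -> (forall i, P i -> csmooth U (h i)) ->
  csmooth U (fun q => \sum_(i <- s | P i) h i q).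
Proof.
move=> oU dh; elim: s => [|i s IH].
  by under eq_fun do rewrite big_nil; exact: csmooth_cst.
under eq_fun do rewrite big_cons.
by case: (boolP (P i)) => // /dh di; exact: csmoothD.
Qed.

Lemma cderive_sum (I : Type) (s : seq I) (h : I -> V -> R[i]) p w :
  (forall i, cdiff (h i) p) ->
  cderive (fun q => \sum_(i <- s) h i q) p w = \sum_(i <- s) cderive (h i) p w.
Proof.
move=> dh; elim: s => [|i s IH].
  by under eq_fun do rewrite big_nil; rewrite big_nil cderive_cst.
under eq_fun do rewrite big_cons.
by rewrite big_cons cderiveD ?IH //; exact: cdiff_sum.
Qed.

Lemma csmooth_cderive (U : set V) h w : open U -> csmooth U h ->
  csmooth U (fun p => cderive h p w).
Proof.
move=> oU sh.
have S j : csmooth U (fun p => w 0 j * cdiff_val h p (delta_mx 0 j)).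
  apply: csmoothM => //; first exact: csmooth_cst.
  by case: sh => s1 s2; split; exact: smooth_diff.
apply: (csmooth_eq oU _ (csmooth_sum (index_enum _) (P := xpredT) oU (fun j _ => S j))) => p /set_mem Up.
by rewrite cderiveE //; exact: csmooth_cdiff sh Up.
Qed.

Lemma cdiff_real (f : V -> R^o) p : differentiable f p -> cdiff (fun q => (f q)%:C%C) p.
Proof. by move=> df; split => //; exact: differentiable_cst. Qed.

Lemma csmooth_real (U : set V) (f : V -> R^o) : smooth_on U f -> csmooth U (fun q => (f q)%:C%C).
Proof. by move=> df; split => //; exact: smooth_cst. Qed.

Lemma cderive_real (f : V -> R^o) p w : differentiable f p ->
  cderive (fun q => (f q)%:C%C) p w = \sum_j w 0 j * ('d f p (delta_mx 0 j))%:C%C.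
Proof.
move=> df; rewrite cderiveE; last exact: cdiff_real.
apply: eq_bigr => j _; congr (_ * _).
exact: (congr2 (fun a b => (a +i* b)%C) erefl (congr1 (fun F => F _) (diff_cst (0 : R^o) p))).
Qed.

End ComplexCalculus.

Section ComplexChain.
Context (R : realType) (n m : nat).
Local Notation C := (@complexify_mx R _ _).

Lemma cdiff_comp (h : 'rV[R]_m -> R[i]) (phi : 'rV[R]_n -> 'rV[R]_m) p :
  differentiable phi p -> cdiff h (phi p) -> cdiff (fun q => h (phi q)) p.
Proof.
move=> dp [h1 h2].
by split; [exact: (differentiable_comp dp h1) | exact: (differentiable_comp dp h2)].
Qed.

Lemma cderive_comp (h : 'rV[R]_m -> R[i]) (phi : 'rV[R]_n -> 'rV[R]_m) p w :
  differentiable phi p -> cdiff h (phi p) ->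
  cderive (fun q => h (phi q)) p w = cderive h (phi p) (w *m C ('J phi p)).
Proof.
move=> dp dh; rewrite !cderiveE //; last exact: cdiff_comp.
have E j : cdiff_val (fun q => h (phi q)) p (delta_mx 0 j)
    = \sum_k (('J phi p) j k)%:C%C * cdiff_val h (phi p) (delta_mx 0 k).
  have [h1 h2] := dh.
  have L (f : 'rV[R]_m -> R^o) : differentiable f (phi p) ->
      'd (fun q => f (phi q)) p (delta_mx 0 j)
      = \sum_k ('J phi p) j k * 'd f (phi p) (delta_mx 0 k).
    move=> df; apply: etrans (diff_compE (delta_mx 0 j) dp df) _.
    rewrite {1}(row_sum_delta ('d phi p (delta_mx 0 j))) linear_sum /=.
    by apply: eq_bigr => k _; rewrite linearZ /= jacobianE.
  apply: etrans (congr2 (fun a b => (a +i* b)%C) (L _ h1) (L _ h2)) _.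
  exact: complex_sum.
rewrite (eq_bigr _ (fun j _ => congr1 _ (E j))).
under eq_bigr do rewrite mulr_sumr.
rewrite exchange_big; apply: eq_bigr => k _; rewrite mxE mulr_suml.
by apply: eq_bigr => j _; rewrite mulrA; congr (_ * _ * _); rewrite [RHS]mxE.
Qed.

End ComplexChain.

(** * Alternating multilinear forms *)

Section Forms.
Context (K : fieldType) (A : lmodType K).

Definition upd k (v : 'I_k -> A) (m : 'I_k) (x : A) : 'I_k -> A :=
  fun l => if l == m then x else v l.

Definition mlin k (F : ('I_k -> A) -> K) := forall v m a x y,
  F (upd v m (a *: x + y)) = a * F (upd v m x) + F (upd v m y).

Definition altern k (F : ('I_k -> A) -> K) := forall (s : 'S_k) v,
  F (v \o s) = (-1) ^+ s * F v.

Lemma upd_id k (v : 'I_k -> A) m : upd v m (v m) = v.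
Proof. by apply/funext => l; rewrite /upd; case: eqP => [->|]. Qed.

Lemma upd_updC k (v : 'I_k -> A) m m' x y : m != m' ->
  upd (upd v m x) m' y = upd (upd v m' y) m x.
Proof.
move=> mm; apply/funext => l; rewrite /upd.
by case: (eqVneq l m') => [->|//]; rewrite eq_sym (negbTE mm).
Qed.

Lemma upd_lift k (v : 'I_k.+1 -> A) i m x :
  upd (fun l => v (lift i l)) m x = (fun l => upd v (lift i m) x (lift i l)).
Proof. by apply/funext => l; rewrite /upd (inj_eq lift_inj). Qed.

Lemma upd_lift_id k (v : 'I_k.+1 -> A) i x l : upd v i x (lift i l) = v (lift i l).
Proof. by rewrite /upd eq_sym (negbTE (neq_lift _ _)). Qed.

Lemma mlin0 k (F : ('I_k -> A) -> K) v m : mlin F -> F (upd v m 0) = 0.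
Proof.
move=> lF; have := lF v m (-1) 0 0; rewrite scaler0 addr0 mulN1r addNr.
by [].
Qed.

Lemma mlin_sum k (F : ('I_k -> A) -> K) v m (I : Type) (s : seq I) (a : I -> K) (x : I -> A) :
  mlin F -> F (upd v m (\sum_(i <- s) a i *: x i)) = \sum_(i <- s) a i * F (upd v m (x i)).
Proof.
move=> lF; elim: s => [|i s IH]; first by rewrite !big_nil mlin0.
by rewrite !big_cons lF IH.
Qed.

(** s' is what remains of s after i is deleted from the source and s i from the
target. *)
Lemma lift_perm_ex k (s : 'S_k.+1) i : exists s', s = lift_perm i (s i) s'.
Proof.
pose f (j : 'I_k) := odflt j (unlift (s i) (s (lift i j))).
have fE j : lift (s i) (f j) = s (lift i j).
  rewrite /f; case: unliftP => [j' -> //|/perm_inj E].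
  by have := neq_lift i j; rewrite E eqxx.
have f_inj : injective f.
  move=> j j' eq_f; apply: (@lift_inj _ i); apply: (@perm_inj _ s).
  by rewrite -!fE eq_f.
exists (perm f_inj); apply/permP => j.
case: (unliftP i j) => [j' ->|->]; last by rewrite lift_perm_id.
by rewrite lift_perm_lift permE fE.
Qed.

(** The second-order terms in the exterior derivative of a pulled back form.
The term where l is deleted and B l j is put in the place of v j cancels with
the term where j is deleted and B j l is put in the place of v l: the
transposition of l and j maps one list of arguments to the other, and the sign
of the permutation that remains after deletion makes the two terms opposite. *)
Lemma altern_second_order k (F : ('I_k -> A) -> K) (v : 'I_k.+1 -> A) (B : 'I_k.+1 -> 'I_k.+1 -> A) :
  (2 : K) != 0 -> altern F -> (forall i j, B i j = B j i) ->
  \sum_(l < k.+1) (-1) ^+ l * \sum_m F (upd (fun l' => v (lift l l')) m (B l (lift l m))) = 0.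
Proof.
move=> two aF BC.
(* The term for the deleted index i and the replaced index j. *)
pose E (i j : 'I_k.+1) := if i == j then 0 else (-1) ^+ i * F (fun l => upd v j (B i j) (lift i l)).
have -> : \sum_(l < k.+1) (-1) ^+ l * \sum_m F (upd (fun l' => v (lift l l')) m (B l (lift l m)))
   = \sum_i \sum_j E i j.
  apply: eq_bigr => i _; rewrite (bigD1_ord i) //= {1}/E eqxx add0r mulr_sumr.
  by apply: eq_bigr => m _; rewrite /E (negbTE (neq_lift _ _)) upd_lift.
have EC i j : E j i = - E i j.
  rewrite /E eq_sym; case: eqP => [|/eqP ij]; first by rewrite oppr0.
  have [s Hs] := lift_perm_ex (tperm i j) j; rewrite tpermR in Hs.
  have Ho : (true = odd j (+) odd i (+) s :> bool).
    by rewrite -odd_lift_perm -Hs odd_tperm ij.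
  rewrite (_ : (fun l => upd v i (B j i) (lift j l))
      = (fun l => upd v j (B i j) (lift i l)) \o s); last first.
    apply/funext => l /=; rewrite -(lift_perm_lift j i s) -Hs BC /upd.
    case: tpermP => [->|lj|/eqP li /eqP lj].
    - by rewrite !eqxx.
    - by have := neq_lift j l; rewrite lj eqxx.
    - by rewrite (negbTE li) (negbTE lj).
  rewrite aF mulrA -mulNr; congr (_ * _).
  rewrite -signr_odd -[in RHS]signr_odd -signr_addb -signrN.
  congr (_ ^+ _); congr nat_of_bool.
  by move: Ho; case: (odd j); case: (odd i); case: (odd_perm s).
have : \sum_i \sum_j E i j = - \sum_i \sum_j E i j.
  rewrite {1}exchange_big /= -sumrN; apply: eq_bigr => i _.
  by rewrite -sumrN; apply: eq_bigr => j _; exact: EC.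
by move/eqP; rewrite -subr_eq0 opprK -mulr2n -mulr_natl mulf_eq0 (negbTE two) => /eqP.
Qed.

End Forms.

(** * Differentiating a multilinear form of varying arguments *)

Section Slots.
Context (R : realType) (n : nat).
Local Notation V := 'rV[R]_n.
Context (d : nat).
Local Notation cV := 'rV[R[i]]_d.
Implicit Types (p q : V).

Lemma mlin_expand k (F : ('I_k -> cV) -> R[i]) v m x : mlin F ->
  F (upd v m x) = \sum_j x 0 j * F (upd v m (delta_mx 0 j)).
Proof. by move=> lF; rewrite {1}(row_sum_delta x) mlin_sum. Qed.

Lemma mlin_slot k (F : ('I_k -> cV) -> R[i]) v m : mlin F ->
  F v = \sum_j v m 0 j * F (upd v m (delta_mx 0 j)).
Proof. by move=> lF; rewrite -{1}(upd_id v m) mlin_expand. Qed.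

Section Family.
Context (k : nat) (w : V -> ('I_k -> cV) -> R[i]).
Hypothesis lw : forall q, mlin (w q).

(** The arguments of index at least m do not vary. Induction on m makes the
arguments vary one after the other. *)
Definition const_from (m : nat) (al : 'I_k -> V -> cV) :=
  forall l : 'I_k, (m <= l)%N -> forall q q', al l q = al l q'.

Lemma const_from_expand m (al : 'I_k -> V -> cV) (Hm : (m < k)%N) j :
  const_from m.+1 al ->
  const_from m (fun l q => upd (al^~ q) (Ordinal Hm) (delta_mx 0 j) l).
Proof.
move=> ca l ml q q'; rewrite /upd; case: (eqVneq l (Ordinal Hm)) => // lm.
by apply: ca; rewrite ltn_neqAle ml andbT eq_sym.
Qed.

(** Expanding the last varying argument in coordinates turns it into scalar
factors and leaves one varying argument less. *)
Lemma csmooth_slots (U : set V) (al : 'I_k -> V -> cV) : open U ->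
  (forall v, csmooth U (fun q => w q v)) ->
  (forall l j, csmooth U (fun q => al l q 0 j)) ->
  csmooth U (fun q => w q (al^~ q)).
Proof.
move=> oU sw; suff H m : const_from m al ->
    (forall l j, csmooth U (fun q => al l q 0 j)) -> csmooth U (fun q => w q (al^~ q)).
  by apply: (H k) => l; rewrite leqNgt ltn_ord.
elim: m al => [|m IH] al ca sal.
  apply: (csmooth_eq oU _ (sw (al^~ 0))) => q _; congr w.
  by apply/funext => l; exact: ca.
case: (ltnP m k) => Hm; last first.
  by apply: IH => // l ml; have := leq_trans Hm ml; rewrite leqNgt ltn_ord.
have S j : csmooth U (fun q => al (Ordinal Hm) q 0 j * w q (upd (al^~ q) (Ordinal Hm) (delta_mx 0 j))).
  apply: csmoothM => //.
  apply: (IH (fun l q => upd (al^~ q) (Ordinal Hm) (delta_mx 0 j) l)).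
    exact: const_from_expand.
  by move=> l i; rewrite /upd; case: (l == _) => //; exact: csmooth_cst.
apply: (csmooth_eq oU _ (csmooth_sum (index_enum _) (P := xpredT) oU (fun j _ => S j))) => q _.
by rewrite -(mlin_slot (al^~ q) (Ordinal Hm) (lw q)).
Qed.

Definition cderive_row (f : V -> cV) p (u : 'rV[R[i]]_n) : cV := \row_j cderive (fun q => f q 0 j) p u.

Lemma cderive_row_cst (f : V -> cV) p u : (forall q q', f q = f q') -> cderive_row f p u = 0.
Proof.
move=> cf; apply/rowP => j; rewrite !mxE.
have -> : (fun q => f q 0 j) = (fun=> f p 0 j) by apply/funext => q; rewrite (cf q p).
exact: cderive_cst.
Qed.

(** The Leibniz rule for a multilinear form whose coefficients and arguments
all depend on the point. *)
Lemma cderive_slots p (al : 'I_k -> V -> cV) u :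
  (forall v, cdiff (fun q => w q v) p) ->
  (forall l j, cdiff (fun q => al l q 0 j) p) ->
  cdiff (fun q => w q (al^~ q)) p /\
  cderive (fun q => w q (al^~ q)) p u = cderive (fun q => w q (al^~ p)) p u
    + \sum_m w p (upd (al^~ p) m (cderive_row (al m) p u)).
Proof.
move=> dw.
pose goal (al : 'I_k -> V -> cV) := cdiff (fun q => w q (al^~ q)) p /\
  cderive (fun q => w q (al^~ q)) p u = cderive (fun q => w q (al^~ p)) p u
    + \sum_m w p (upd (al^~ p) m (cderive_row (al m) p u)).
suff H m : const_from m al -> (forall l j, cdiff (fun q => al l q 0 j) p) -> goal al.
  by move=> dal; apply: (H k) => // l; rewrite leqNgt ltn_ord.
elim: m al => [|m IH] al ca dal.
  have E : (fun q => w q (al^~ q)) = (fun q => w q (al^~ p)).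
    by apply/funext => q; congr w; apply/funext => l; exact: ca.
  rewrite /goal E; split; first exact: dw.
  by rewrite big1 ?addr0 // => i _; rewrite cderive_row_cst ?mlin0 //; exact: ca.
case: (ltnP m k) => Hm; last first.
  by apply: IH => // l ml; have := leq_trans Hm ml; rewrite leqNgt ltn_ord.
set l0 := Ordinal Hm.
pose be j : 'I_k -> V -> cV := fun l q => upd (al^~ q) l0 (delta_mx 0 j) l.
have Hbe j : goal (be j).
  apply: IH; first exact: const_from_expand.
  by move=> l i; rewrite /be /upd; case: (l == _) => //; exact: cdiff_cst.
have E : (fun q => w q (al^~ q)) = (fun q => \sum_j al l0 q 0 j * w q ((be j)^~ q)).
  by apply/funext => q; exact: (mlin_slot (al^~ q) l0 (lw q)).
have D j : cdiff (fun q => al l0 q 0 j * w q ((be j)^~ q)) p.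
  by apply: cdiffM => //; exact: (Hbe j).1.
rewrite /goal E; split; first exact: cdiff_sum.
rewrite cderive_sum //.
under eq_bigr => j _ do rewrite (cderiveM _ (dal l0 j) (Hbe j).1) (Hbe j).2 mulrDr.
rewrite !big_split /=.
have -> : \sum_j cderive (fun q => al l0 q 0 j) p u * w p ((be j)^~ p)
    = w p (upd (al^~ p) l0 (cderive_row (al l0) p u)).
  by rewrite [RHS]mlin_expand //; apply: eq_bigr => j _; rewrite mxE.
have -> : \sum_j al l0 p 0 j * cderive (fun q => w q ((be j)^~ p)) p u
    = cderive (fun q => w q (al^~ p)) p u.
  have -> : (fun q => w q (al^~ p)) = (fun q => \sum_j al l0 p 0 j * w q ((be j)^~ p)).
    by apply/funext => q; exact: (mlin_slot (al^~ p) l0 (lw q)).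
  rewrite cderive_sum; last by move=> j; apply: cdiffM => //; exact: cdiff_cst.
  by apply: eq_bigr => j _; rewrite cderiveZ.
rewrite addrCA; congr (_ + _).
rewrite [RHS](bigD1 l0) //=; congr (_ + _).
under eq_bigr do rewrite mulr_sumr.
rewrite exchange_big /= (bigD1 l0) //= big1 ?add0r; last first.
  move=> j _; rewrite (_ : cderive_row _ _ _ = 0) ?mlin0 ?mulr0 //.
  by apply: cderive_row_cst => q q'; rewrite /be /upd eqxx.
apply: eq_bigr => l ll.
pose z := upd (al^~ p) l (cderive_row (al l) p u).
have zl : z l0 = al l0 p by rewrite /z /upd eq_sym (negbTE ll).
rewrite -/z -[z in RHS](upd_id z l0) zl mlin_expand //; apply: eq_bigr => j _.
congr (_ * w p _).
have -> : cderive_row (be j l) p u = cderive_row (al l) p u by rewrite /be /upd (negbTE ll).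
by apply: upd_updC; rewrite eq_sym.
Qed.

End Family.
End Slots.

(** * The exterior derivative on open sets of R^n *)

Section ExteriorDerivative.
Context (R : realType) (n : nat).
Local Notation V := 'rV[R]_n.
Local Notation cV := 'rV[R[i]]_n.
Local Notation C := (@complexify_mx R _ _).
Implicit Types (p q : V).

Definition chart_form k := V -> ('I_k -> cV) -> R[i].

(** The exterior derivative of a form given in coordinates; its arguments are
constant vector fields. *)
Definition ext_der k (w : chart_form k) : chart_form k.+1 := fun p v =>
  \sum_(l < k.+1) (-1) ^+ l * cderive (fun q => w q (fun m => v (lift l m))) p (v l).

Lemma ext_der_near k (U : set V) (w w' : chart_form k) p : open U -> U p ->
  (forall q v, U q -> w q v = w' q v) -> ext_der w p = ext_der w' p.
Proof.
move=> oU Up ww; apply/funext => v; apply: eq_bigr => l _; congr (_ * _).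
by apply: (cderive_near _ oU Up) => q /set_mem Uq; exact: ww.
Qed.

Lemma ext_der_mlin k (w : chart_form k) p : (forall q, mlin (w q)) ->
  (forall v, cdiff (fun q => w q v) p) -> mlin (ext_der w p).
Proof.
move=> lw dw v m a x y; rewrite /ext_der mulr_sumr -big_split /=; apply: eq_bigr => l _.
rewrite mulrCA -mulrDr; congr (_ * _).
case: (unliftP l m) => [m' ->|->].
  have E z : (fun q => w q (fun m0 => upd v (lift l m') z (lift l m0)))
      = (fun q => w q (upd (fun m0 => v (lift l m0)) m' z)).
    by apply/funext => q; rewrite upd_lift.
  have El z : upd v (lift l m') z l = v l by rewrite /upd (negbTE (neq_lift _ _)).
  rewrite !E !El.
  have -> : (fun q => w q (upd (fun m0 => v (lift l m0)) m' (a *: x + y)))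
     = (fun q => a * w q (upd (fun m0 => v (lift l m0)) m' x) + w q (upd (fun m0 => v (lift l m0)) m' y)).
    by apply/funext => q; rewrite lw.
  rewrite cderiveD ?cderiveZ //.
  by apply: cdiffM => //; exact: cdiff_cst.
have E z : (fun q => w q (fun m0 => upd v l z (lift l m0))) = (fun q => w q (fun m0 => v (lift l m0))).
  by apply/funext => q; congr w; apply/funext => m0; exact: upd_lift_id.
by rewrite !E /upd eqxx cderive_dirD.
Qed.

(** A permutation s of the k + 1 arguments induces, after deletion of l, a
permutation of the other k; odd_lift_perm relates the signs. *)
Lemma ext_der_altern k (w : chart_form k) p : (forall q, altern (w q)) ->
  (forall v, cdiff (fun q => w q v) p) -> altern (ext_der w p).
Proof.
move=> aw dw s v; rewrite /ext_der mulr_sumr [RHS](reindex_inj (@perm_inj _ s)) /=.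
apply: eq_bigr => l _.
have [s' Hs] := lift_perm_ex s l.
have -> : (fun q => w q (fun m => (v \o s) (lift l m)))
    = (fun q => (-1) ^+ s' * w q (fun m => v (lift (s l) m))).
  apply/funext => q; rewrite -aw; congr w; apply/funext => m /=.
  by rewrite {1}Hs lift_perm_lift.
rewrite cderiveZ //= !mulrA; congr (_ * _).
rewrite -signr_odd -[X in _ = _ * X]signr_odd -!signr_addb; congr (_ ^+ nat_of_bool _).
rewrite [in RHS]Hs odd_lift_perm -!Hs.
by case: (odd l); case: (odd_perm s'); case: (odd (s l)).
Qed.

Lemma ext_der_csmooth k (U : set V) (w : chart_form k) v : open U ->
  (forall v, csmooth U (fun q => w q v)) -> csmooth U (fun q => ext_der w q v).
Proof.
move=> oU sw; apply: csmooth_sum => // l _; apply: csmoothM => //; first exact: csmooth_cst.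
exact: csmooth_cderive.
Qed.

Lemma jacobian_diffC (U : set V) (phi : V -> V) p i j k : open U -> U p -> smooth_on U phi ->
  'd (fun q => ('J phi q) i k : R^o) p (delta_mx 0 j)
  = 'd (fun q => ('J phi q) j k : R^o) p (delta_mx 0 i).
Proof.
move=> oU Up sphi.
have sk : smooth_on U (fun q => phi q 0 k : R^o) := smooth_coord oU k sphi.
have E l u : 'd (fun q => ('J phi q) l k : R^o) p u
    = 'd (fun q => 'd (fun y => phi y 0 k : R^o) q (delta_mx 0 l) : R^o) p u.
  have N : {in U, (fun q => 'd (fun y => phi y 0 k : R^o) q (delta_mx 0 l) : R^o)
      =1 (fun q => ('J phi q) l k : R^o)}.
    move=> q /set_mem Uq; rewrite jacobianE.
    exact: (diff_coordE _ _ (smooth_differentiable sphi Uq)).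
  have [_ F] := near_eq_differentiable (open_near_eq oU N Up)
    (smooth_differentiable (smooth_diff (delta_mx 0 l) sk) Up).
  exact: (congr1 (fun h => h u) F).
apply: etrans (E i (delta_mx 0 j)) _; apply: etrans _ (esym (E j (delta_mx 0 i))).
exact: (diff_diffC _ _ oU Up sk).
Qed.

Lemma cdiff_jacobian (U : set V) (phi : V -> V) p (b : cV) k : open U -> U p -> smooth_on U phi ->
  cdiff (fun q => (b *m C ('J phi q)) 0 k) p.
Proof.
move=> oU Up sphi.
have E q : (b *m C ('J phi q)) 0 k = \sum_i b 0 i * (('J phi q) i k)%:C%C.
  by rewrite mxE; apply: eq_bigr => i _; congr (_ * _); rewrite mxE.
rewrite (funext E); apply: cdiff_sum => i _; apply: cdiffM; first exact: cdiff_cst.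
by apply: cdiff_real; exact: smooth_differentiable (smooth_jacobian oU sphi i k) Up.
Qed.

(** The second derivative of phi is symmetric. *)
Lemma cderive_row_jacobianC (U : set V) (phi : V -> V) p (a b : cV) : open U -> U p -> smooth_on U phi ->
  cderive_row (fun q => b *m C ('J phi q)) p a = cderive_row (fun q => a *m C ('J phi q)) p b.
Proof.
move=> oU Up sphi.
have dJ i k : differentiable (fun q => ('J phi q) i k : R^o) p.
  exact: smooth_differentiable (smooth_jacobian oU sphi i k) Up.
have E (x y : cV) k : cderive (fun q => (y *m C ('J phi q)) 0 k) p x
    = \sum_i \sum_j y 0 i * x 0 j * ('d (fun q => ('J phi q) i k : R^o) p (delta_mx 0 j))%:C%C.
  have -> : (fun q => (y *m C ('J phi q)) 0 k) = (fun q => \sum_i y 0 i * (('J phi q) i k)%:C%C).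
    by apply/funext => q; rewrite mxE; apply: eq_bigr => i _; congr (_ * _); rewrite mxE.
  rewrite cderive_sum; last by move=> i; exact: (cdiffM (cdiff_cst _ _) (cdiff_real (dJ i k))).
  apply: eq_bigr => i _; rewrite cderiveZ; last exact: cdiff_real.
  by rewrite cderive_real // mulr_sumr; apply: eq_bigr => j _; rewrite mulrA.
apply/rowP => k; rewrite [LHS]mxE [RHS]mxE (E a b k) (E b a k) exchange_big /=.
apply: eq_bigr => j _; apply: eq_bigr => i _.
rewrite [b 0 i * _]mulrC; congr (_ * _%:C%C).
exact: (jacobian_diffC _ _ _ oU Up sphi).
Qed.

Lemma two_neq0 : (2 : R[i]) != 0.
Proof. by rewrite pnatr_eq0. Qed.

(** Naturality of the exterior derivative. The Leibniz rule gives the pull-back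
of the exterior derivative plus terms with a second derivative of phi, and
these cancel by altern_second_order. *)
Theorem ext_der_pullback k (U : set V) (phi : V -> V) (w : chart_form k) p v :
  open U -> U p -> smooth_on U phi ->
  (forall q, mlin (w q)) -> altern (w (phi p)) ->
  (forall v, cdiff (fun q => w q v) (phi p)) ->
  ext_der (fun q v => w (phi q) (fun m => v m *m C ('J phi q))) p v
  = ext_der w (phi p) (fun m => v m *m C ('J phi p)).
Proof.
move=> oU Up sphi lw aw dw.
have dphi := smooth_differentiable sphi Up.
pose B i j := cderive_row (fun q => v j *m C ('J phi q)) p (v i).
have BC i j : B i j = B j i by exact: cderive_row_jacobianC oU Up sphi.
have dJ (b : cV) j : cdiff (fun q => (b *m C ('J phi q)) 0 j) p.
  exact: cdiff_jacobian oU Up sphi.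
pose X (l : 'I_k.+1) :=
  cderive (fun q => w q (fun m => v (lift l m) *m C ('J phi p))) (phi p) (v l *m C ('J phi p)).
pose Y (l : 'I_k.+1) :=
  \sum_m w (phi p) (upd (fun m => v (lift l m) *m C ('J phi p)) m (B l (lift l m))).
have Z : \sum_(l < k.+1) (-1) ^+ l * Y l = 0.
  exact: (altern_second_order (fun i => v i *m C ('J phi p)) two_neq0 aw BC).
have T (l : 'I_k.+1) :
    (-1) ^+ l * cderive (fun q => w (phi q) (fun m => v (lift l m) *m C ('J phi q))) p (v l)
    = (-1) ^+ l * X l + (-1) ^+ l * Y l.
  have [_ Es] := @cderive_slots R n n k (fun q => w (phi q)) (fun q => lw (phi q)) p
    (fun m q => v (lift l m) *m C ('J phi q)) (v l)
    (fun v => cdiff_comp dphi (dw v)) (fun l' j => dJ _ j).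
  rewrite -mulrDr; apply: (congr1 (fun z => (-1) ^+ l * z)); apply: etrans Es _.
  apply: (congr1 (fun z => z + Y l)).
  exact: (cderive_comp (v l) dphi (dw (fun m => v (lift l m) *m C ('J phi p)))).
apply: etrans (eq_bigr _ (fun l _ => T l)) _.
by rewrite big_split /= Z addr0.
Qed.

End ExteriorDerivative.

(** * Differential forms on the group *)

Section ManifoldForms.
Context (R : realType) (n : nat) (G : lieGroupType R n).
Local Notation c := (@chart_at R n G).
Local Notation psi x := (cinv (chart_at x)).
Local Notation C := (@complexify_mx R _ _).
Local Notation cV := 'rV[R[i]]_n.

Definition form_rep k (w : cform G k) (x : G) : chart_form R n k := fun p v =>
  w (psi x p) (fun m => v m *m C (frame_mx x p)).

(** Differential forms in the usual sense. *)
Definition smooth_alt k (w : cform G k) := [/\ forall x, mlin (w x), forall x, altern (w x) &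
  forall x v, csmooth (ccod (c x)) (fun p => form_rep w x p v)].

Definition form_pull k (f : G -> G) (w : cform G k) : cform G k := fun x v =>
  w (f x) (fun m => v m *m C (dmap f x)).

Lemma ext_dE k (w : cform G k) x v : ext_d w x v = ext_der (form_rep w x) (c x x) v.
Proof. by rewrite /ext_d /ext_der frame_mxE. Qed.

Lemma mlin_lin k (F : ('I_k -> cV) -> R[i]) (L : 'I_k -> 'M[R[i]]_n) :
  mlin F -> mlin (fun v => F (fun m => v m *m L m)).
Proof.
move=> lF v m a x y.
have E z : (fun m' => upd v m z m' *m L m') = upd (fun m' => v m' *m L m') m (z *m L m).
  by apply/funext => m'; rewrite /upd; case: eqP => [->|].
by rewrite !E mulmxDl -scalemxAl lF.
Qed.

Lemma altern_lin k (F : ('I_k -> cV) -> R[i]) (L : 'M[R[i]]_n) :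
  altern F -> altern (fun v => F (fun m => v m *m L)).
Proof. by move=> aF s v; rewrite -aF. Qed.

Lemma form_rep_mlin k (w : cform G k) x p : (forall x, mlin (w x)) -> mlin (form_rep w x p).
Proof. by move=> lw; exact: mlin_lin. Qed.

Lemma form_rep_altern k (w : cform G k) x p : (forall x, altern (w x)) -> altern (form_rep w x p).
Proof. by move=> aw; exact: altern_lin. Qed.

Lemma form_rep_pull k (f : G -> G) (w : cform G k) x y p v : smooth_self f -> overlap f x y p ->
  form_rep (form_pull f w) x p v = form_rep w y (loc f x y p) (fun m => v m *m C (jac f x y p)).
Proof.
move=> sf Op; rewrite /form_rep /form_pull.
have -> : psi y (loc f x y p) = f (psi x p) by apply: cmapK; case: Op.
by congr w; apply/funext => m; rewrite -!mulmxA -!complexify_mulmx jac_frame_mx.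
Qed.

(** Naturality for maps of the group. Applied to the identity with the chart of
another point, it says that the exterior derivative may be computed in any
chart. *)
Lemma ext_der_form_pull k (f : G -> G) (w : cform G k) x y p v : smooth_self f -> smooth_alt w ->
  overlap f x y p ->
  ext_der (form_rep (form_pull f w) x) p v = ext_der (form_rep w y) (loc f x y p) (fun m => v m *m C (jac f x y p)).
Proof.
move=> sf [lw aw sw] Op.
have oU := open_overlap sf (x := x) (y := y).
have Cp : ccod (c y) (loc f x y p) by apply: cmap_cod; case: Op.
have E q u : overlap f x y q -> form_rep (form_pull f w) x q u
    = form_rep w y (loc f x y q) (fun m => u m *m C ('J (loc f x y) q)).
  by move=> Oq; rewrite (form_rep_pull _ _ sf Oq) -jacE.
rewrite (ext_der_near oU Op E) -jacE.
apply: (ext_der_pullback v oU Op (proj2 sf x y)).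
- by move=> q; exact: form_rep_mlin.
- exact: form_rep_altern.
- by move=> u; exact: csmooth_cdiff (sw y u) Cp.
Qed.

Lemma form_pull_id k (w : cform G k) : form_pull id w = w.
Proof.
apply/funext => x; apply/funext => v; rewrite /form_pull; congr w; apply/funext => m.
by rewrite dmap_id complexify1 mulmx1.
Qed.

(** The exterior derivative at psi x p is computed in the chart attached to
that point; it is the same as the one computed in the chart at x. *)
Lemma form_rep_ext_d k (w : cform G k) x p v : smooth_alt w -> ccod (c x) p ->
  form_rep (ext_d w) x p v = ext_der (form_rep w x) p v.
Proof.
move=> gw Cp; have Op := overlap_frame Cp.
have := ext_der_form_pull v (smooth_self_id G) gw Op.
by rewrite form_pull_id -frame_mx_jac => ->; rewrite /form_rep ext_dE.
Qed.

Lemma ext_d_form_pull k (f : G -> G) (w : cform G k) : smooth_self f -> smooth_alt w ->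
  ext_d (form_pull f w) = form_pull f (ext_d w).
Proof.
move=> sf gw; apply/funext => x; apply/funext => v.
by rewrite ext_dE (ext_der_form_pull v sf gw (overlap_base f x)) loc_base -dmap_jac /form_pull ext_dE.
Qed.

Lemma smooth_alt_ext_d k (w : cform G k) : smooth_alt w -> smooth_alt (ext_d w).
Proof.
move=> gw; have [lw aw sw] := gw.
have dw x u : cdiff (fun q => form_rep w x q u) (c x x) by exact: csmooth_cdiff (sw x u) (chart_cod x).
have E x : ext_d w x = ext_der (form_rep w x) (c x x) by apply/funext => v; rewrite ext_dE.
split=> [x|x|x v].
- rewrite E; apply: ext_der_mlin => [q|v]; [exact: form_rep_mlin | exact: dw].
- rewrite E; apply: ext_der_altern => [q|v]; [exact: form_rep_altern | exact: dw].
- have oC := @ccod_open _ _ _ (c x).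
  apply: (csmooth_eq oC _ (ext_der_csmooth v oC (sw x))) => p /set_mem Cp.
  by rewrite form_rep_ext_d.
Qed.

Definition form_lin k (a : R[i]) (w w' : cform G k) : cform G k := fun x v => a * w x v + w' x v.

Lemma ext_d_form_lin k a (w w' : cform G k) : smooth_alt w -> smooth_alt w' ->
  ext_d (form_lin a w w') = form_lin a (ext_d w) (ext_d w').
Proof.
move=> [_ _ sw] [_ _ sw']; apply/funext => x; apply/funext => v.
rewrite /form_lin !ext_dE /ext_der mulr_sumr -big_split /=; apply: eq_bigr => l _.
rewrite mulrCA -mulrDr; congr (_ * _).
have dw u : cdiff (fun q => form_rep w x q u) (c x x) by exact: csmooth_cdiff (sw x u) (chart_cod x).
have dw' u : cdiff (fun q => form_rep w' x q u) (c x x) by exact: csmooth_cdiff (sw' x u) (chart_cod x).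
rewrite -cderiveZ // -cderiveD //; apply: cdiffM => //; exact: cdiff_cst.
Qed.

Section TypeParts.
Context (I : G -> 'M[R]_n).

Lemma type_part_form_lin k p a (w w' : cform G k) :
  type_part I p (form_lin a w w') = form_lin a (type_part I p w) (type_part I p w').
Proof.
apply/funext => x; apply/funext => v.
by rewrite /form_lin /type_part mulr_sumr -big_split.
Qed.

(** A map that commutes with I is holomorphic, and its pull-back preserves
types. *)
Lemma type_part_form_pull k p (f : G -> G) (w : cform G k) :
  (forall x, I x *m dmap f x = dmap f x *m I (f x)) ->
  type_part I p (form_pull f w) = form_pull f (type_part I p w).
Proof.
move=> If; apply/funext => x; apply/funext => v.
rewrite /type_part /form_pull; apply: eq_bigr => S _; congr w; apply/funext => l.
rewrite -!mulmxA; congr (_ *m _).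
have E : C (I x) *m C (dmap f x) = C (dmap f x) *m C (I (f x)).
  by rewrite -!complexify_mulmx If.
case: (l \in S).
  rewrite /proj10 -scalemxAl -scalemxAr; congr (_ *: _).
  by rewrite mulmxBl mulmxBr mul1mx mulmx1 -scalemxAl -scalemxAr E.
rewrite /proj01 -scalemxAl -scalemxAr; congr (_ *: _).
by rewrite mulmxDl mulmxDr mul1mx mulmx1 -scalemxAl -scalemxAr E.
Qed.

Lemma type_part_altern k p (w : cform G k) x : (forall x, altern (w x)) -> altern (type_part I p w x).
Proof.
move=> aw s v; rewrite /type_part mulr_sumr.
have s_inj : injective (fun S : {set 'I_k} => s @: S) by exact: imset_inj perm_inj.
rewrite [RHS](reindex_inj s_inj) /=; apply: eq_big => [S|S _].
  by rewrite card_imset //; exact: perm_inj.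
rewrite -aw; congr w; apply/funext => l /=.
by rewrite mem_imset //; exact: perm_inj.
Qed.

(** The projections proj10 and proj01 in the coordinates of the chart at x. *)
Definition rproj (b : bool) x p : 'M[R[i]]_n :=
  if b then 2^-1 *: (1%:M - 'i%C *: C (endo_rep I x p))
  else 2^-1 *: (1%:M + 'i%C *: C (endo_rep I x p)).

Hypothesis HI : linv_endo I.

Lemma rproj_frame_mx b x p : ccod (c x) p ->
  rproj b x p *m C (frame_mx x p) = C (frame_mx x p) *m (if b then proj10 I (psi x p) else proj01 I (psi x p)).
Proof.
move=> Cp; have E : C (endo_rep I x p) *m C (frame_mx x p) = C (frame_mx x p) *m C (I (psi x p)).
  by rewrite -!complexify_mulmx endo_repE.
case: b; rewrite /rproj /proj10 /proj01 -scalemxAl -scalemxAr; congr (_ *: _).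
  by rewrite mulmxBl mulmxBr mul1mx mulmx1 -scalemxAl -scalemxAr E.
by rewrite mulmxDl mulmxDr mul1mx mulmx1 -scalemxAl -scalemxAr E.
Qed.

Lemma form_rep_type_part k r (w : cform G k) x p v : ccod (c x) p ->
  form_rep (type_part I r w) x p v
  = \sum_(S : {set 'I_k} | #|S| == r) form_rep w x p (fun l => v l *m rproj (l \in S) x p).
Proof.
move=> Cp; apply: eq_bigr => S _; rewrite /form_rep; congr w; apply/funext => l.
by rewrite -!mulmxA; congr (_ *m _); rewrite rproj_frame_mx //; case: (l \in S).
Qed.

Lemma csmooth_rproj b x i j : csmooth (ccod (c x)) (fun p => rproj b x p i j).
Proof.
have oC := @ccod_open _ _ _ (c x).
have S : csmooth (ccod (c x)) (fun p => (endo_rep I x p i j)%:C%C).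
  exact: (csmooth_real (@smooth_endo_rep _ _ _ I x i j)).
pose z : R[i] := if b then - 2^-1 * 'i%C else 2^-1 * 'i%C.
have S2 : csmooth (ccod (c x)) (fun p => 2^-1 * (1%:M : 'M[R[i]]_n) i j + z * (endo_rep I x p i j)%:C%C).
  apply: csmoothD => //; first exact: csmooth_cst.
  by apply: csmoothM => //; exact: csmooth_cst.
apply: (csmooth_eq oC _ S2) => p _; rewrite /z /rproj; case: b {z S2}.
  by rewrite [RHS]mxE [in RHS]mxE [X in _ * (_ + X)]mxE [X in _ * (_ + - X)]mxE [X in _ * (_ + - (_ * X))]mxE; ring.
by rewrite [RHS]mxE [in RHS]mxE [X in _ * (_ + X)]mxE [X in _ * (_ + (_ * X))]mxE; ring.
Qed.

Lemma smooth_alt_type_part k r (w : cform G k) : smooth_alt w -> smooth_alt (type_part I r w).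
Proof.
move=> [lw aw sw]; split=> [x|x|x v].
- move=> v m a y z; rewrite /type_part mulr_sumr -big_split; apply: eq_bigr => S _.
  exact: (mlin_lin (fun l => if l \in S then proj10 I x else proj01 I x) (lw x) v m a y z).
- exact: type_part_altern.
have oC := @ccod_open _ _ _ (c x).
have S1 (S : {set 'I_k}) : csmooth (ccod (c x))
    (fun p => form_rep w x p (fun l => v l *m rproj (l \in S) x p)).
  apply: (csmooth_slots (w := form_rep w x) (fun q => form_rep_mlin x q lw) (al := fun l p => v l *m rproj (l \in S) x p) oC (sw x)).
  move=> l j.
  have S2 : csmooth (ccod (c x)) (fun q => \sum_i v l 0 i * rproj (l \in S) x q i j).
    apply: csmooth_sum => // i _; apply: csmoothM => //; first exact: csmooth_cst.
    exact: csmooth_rproj.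
  by apply: (csmooth_eq oC _ S2) => q _; rewrite mxE.
apply: (csmooth_eq oC _ (csmooth_sum (index_enum _) (P := fun S : {set 'I_k} => #|S| == r) oC (fun S _ => S1 S))).
by move=> p /set_mem Cp; rewrite form_rep_type_part.
Qed.

End TypeParts.
End ManifoldForms.

(** * The fundamental form and the pluriclosed condition *)

Section FundamentalForm.
Context (R : realType) (n : nat) (G : lieGroupType R n).
Local Notation c := (@chart_at R n G).
Local Notation psi x := (cinv (chart_at x)).
Local Notation C := (@complexify_mx R _ _).
Local Notation cV := 'rV[R[i]]_n.

Lemma ord2P (i : 'I_2) : i = ord0 \/ i = ord_max.
Proof. by case: i => [[|[|//]] Hi]; [left | right]; apply: val_inj. Qed.

Lemma perm2P (s : 'S_2) : s = 1%g \/ s = tperm ord0 ord_max.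
Proof.
have inj : s ord0 != s ord_max by rewrite (inj_eq perm_inj).
case: (ord2P (s ord0)) => E0; case: (ord2P (s ord_max)) => E1; rewrite E0 E1 // in inj.
  by left; apply/permP => i; rewrite perm1; case: (ord2P i) => ->.
by right; apply/permP => i; case: (ord2P i) => ->; rewrite ?tpermL ?tpermR.
Qed.

Lemma cform2_of_mlin (b : tensor2 G) x : mlin (cform2_of b x).
Proof.
move=> v m a y z; rewrite /cform2_of mulr_sumr -big_split; apply: eq_bigr => i _ /=.
rewrite mulr_sumr -big_split; apply: eq_bigr => j _ /=; rewrite /upd.
by case: (ord2P m) => -> /=; rewrite !mxE; ring.
Qed.

Lemma cform2_of_altern (b : tensor2 G) x : (forall u v, b x u v = - b x v u) ->
  altern (cform2_of b x).
Proof.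
move=> bs s v; case: (perm2P s) => ->.
  rewrite odd_perm1 expr0 mul1r; congr cform2_of.
  by apply/funext => i /=; rewrite perm1.
rewrite odd_tperm /= expr1 mulN1r /cform2_of exchange_big -sumrN.
apply: eq_bigr => i _ /=; rewrite -sumrN; apply: eq_bigr => j _.
by rewrite tpermL tpermR bs rmorphN /=; ring.
Qed.

Lemma cform2_of_lin (b : tensor2 G) x (v : 'I_2 -> cV) (A : 'M[R]_n) : bilin b ->
  cform2_of b x (fun m => v m *m C A)
  = \sum_i \sum_j v ord0 0 i * v ord_max 0 j * (b x (delta_mx 0 i *m A) (delta_mx 0 j *m A))%:C%C.
Proof.
move=> bb; rewrite /cform2_of.
have E i j : (b x (delta_mx 0 i *m A) (delta_mx 0 j *m A))%:C%C
   = \sum_k \sum_l (A i k)%:C%C * (A j l)%:C%C * (b x (delta_mx 0 k) (delta_mx 0 l))%:C%C.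
  rewrite (bilin_sum _ _ _ bb) rmorph_sum; apply: eq_bigr => k _.
  rewrite rmorph_sum; apply: eq_bigr => l _.
  by rewrite -!rowE !mxE !rmorphM.
have M m k : (v m *m C A) 0 k = \sum_i v m 0 i * (A i k)%:C%C.
  by rewrite mxE; apply: eq_bigr => i _; congr (_ * _); rewrite mxE.
under [RHS]eq_bigr do under eq_bigr do (rewrite E mulr_sumr; under eq_bigr do rewrite mulr_sumr).
under [RHS]eq_bigr do rewrite exchange_big.
rewrite [RHS]exchange_big; apply: eq_bigr => k _ /=.
under [RHS]eq_bigr do rewrite exchange_big.
rewrite [RHS]exchange_big; apply: eq_bigr => l _ /=.
rewrite !M mulr_suml mulr_suml; apply: eq_bigr => i _.
rewrite mulr_sumr mulr_suml; apply: eq_bigr => j _.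
by ring.
Qed.

Context (I : G -> 'M[R]_n).
Hypothesis HI : linv_endo I.
Hypothesis I2 : I 1%g *m I 1%g = - 1%:M.

Definition fund_form (g : tensor2 G) : tensor2 G := fundamental_form I g.

(** The tensors among which the pluriclosed condition is linear; positivity is
left out so that they form a vector space. *)
Definition inv_hermitian (g : tensor2 G) :=
  [/\ bilin g, linv g, forall x u v, g x u v = g x v u & hermitian_metric I g].

Lemma bilin_fund_form g : bilin g -> bilin (fund_form g).
Proof.
move=> [gl gr]; split=> x a u u' v; rewrite /fund_form /fundamental_form ?mulmxDl -?scalemxAl.
  exact: gl.
exact: gr.
Qed.

Lemma fund_form_pull g f : (forall x, I x *m dmap f x = dmap f x *m I (f x)) ->
  fund_form (pull f g) = pull f (fund_form g).
Proof.
move=> If; apply/funext => x; apply/funext => u; apply/funext => v.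
by rewrite /fund_form /fundamental_form /pull -!mulmxA If.
Qed.

Lemma linv_fund_form g : linv g -> linv (fund_form g).
Proof.
move=> lg a x; rewrite -fund_form_pull; last by move=> y; exact: HI.
apply/funext => u; apply/funext => v.
by rewrite /fund_form /fundamental_form lg.
Qed.

(** g (I u, v) = g (I I u, I v) = - g (u, I v). *)
Lemma fund_form_skew g x u v : inv_hermitian g -> fund_form g x u v = - fund_form g x v u.
Proof.
move=> [[gl gr] lg gs gh].
rewrite /fund_form /fundamental_form -(gh x (u *m I x)) -!mulmxA (linv_endo_square x HI I2).
rewrite (gs _ (v *m I x)) mulmxN mulmx1.
have := gl x (-1) u 0 (v *m I x); rewrite scaleN1r addr0 mulN1r => ->.
have g0 : g x 0 (v *m I x) = 0.
  by have := gl x (-1) 0 0 (v *m I x); rewrite scaler0 addr0 mulN1r addNr.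
by rewrite g0 addr0.
Qed.

Lemma smooth_alt_fund_form g : inv_hermitian g -> smooth_alt (cform2_of (fund_form g)).
Proof.
move=> ng; have [bg lg _ _] := ng; have bf := bilin_fund_form bg.
split=> [x|x|x v].
- exact: cform2_of_mlin.
- by apply: cform2_of_altern => u v; exact: fund_form_skew.
have oC := @ccod_open _ _ _ (c x).
have S i j : csmooth (ccod (c x)) (fun p =>
    (fund_form g (psi x p) (delta_mx 0 i *m frame_mx x p) (delta_mx 0 j *m frame_mx x p))%:C%C).
  by apply: csmooth_real; rewrite -frame_mxE; exact: linv_smooth bf (linv_fund_form lg) x _ _.
have S2 : csmooth (ccod (c x)) (fun p => \sum_i \sum_j v ord0 0 i * v ord_max 0 j *
    (fund_form g (psi x p) (delta_mx 0 i *m frame_mx x p) (delta_mx 0 j *m frame_mx x p))%:C%C).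
  apply: csmooth_sum => // i _; apply: csmooth_sum => // j _.
  by apply: csmoothM => //; exact: csmooth_cst.
by apply: (csmooth_eq oC _ S2) => p _; rewrite /form_rep cform2_of_lin.
Qed.

Definition ddbar (w : cform G 2) : cform G 4 :=
  type_part I 2 (ext_d (type_part I 1 (ext_d w))).

Lemma sktP g : skt I g <-> forall x v, ddbar (cform2_of (fund_form g)) x v = 0.
Proof. by []. Qed.

Lemma ddbar_form_pull f w : (forall x, I x *m dmap f x = dmap f x *m I (f x)) ->
  smooth_self f -> smooth_alt w -> ddbar (form_pull f w) = form_pull f (ddbar w).
Proof.
move=> If sf gw.
have g1 : smooth_alt (type_part I 1 (ext_d w)) := smooth_alt_type_part HI 1 (smooth_alt_ext_d gw).
have E1 := etrans (congr1 (type_part I 1) (ext_d_form_pull sf gw)) (type_part_form_pull 1 (ext_d w) If).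
have E2 := etrans (congr1 (@ext_d R n G _) E1) (ext_d_form_pull sf g1).
exact: etrans (congr1 (type_part I 2) E2) (type_part_form_pull 2 _ If).
Qed.

Lemma ddbar_form_lin a w w' : smooth_alt w -> smooth_alt w' ->
  ddbar (form_lin a w w') = form_lin a (ddbar w) (ddbar w').
Proof.
move=> gw gw'.
have g1 : smooth_alt (type_part I 1 (ext_d w)) := smooth_alt_type_part HI 1 (smooth_alt_ext_d gw).
have g1' : smooth_alt (type_part I 1 (ext_d w')) := smooth_alt_type_part HI 1 (smooth_alt_ext_d gw').
have E1 := etrans (congr1 (type_part I 1) (ext_d_form_lin a gw gw')) (type_part_form_lin I 1 a _ _).
have E2 := etrans (congr1 (@ext_d R n G _) E1) (ext_d_form_lin a g1 g1').
exact: etrans (congr1 (type_part I 2) E2) (type_part_form_lin I 2 a _ _).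
Qed.

Lemma cform2_of_pull f (b : tensor2 G) : bilin b ->
  cform2_of (pull f b) = form_pull f (cform2_of b).
Proof.
by move=> bb; apply/funext => x; apply/funext => v; rewrite /form_pull cform2_of_lin.
Qed.

Lemma inv_hermitian_pull_rtrans g h : (forall x, I x *m dmap (rtrans h) x = dmap (rtrans h) x *m I (x * h)%g) ->
  inv_hermitian g -> inv_hermitian (pull (rtrans h) g).
Proof.
move=> Ih [bg lg gs gh]; split.
- exact: bilin_pull.
- exact: linv_pull_rtrans.
- by move=> x u v; exact: gs.
- by move=> x u v; rewrite /pull -!mulmxA Ih !mulmxA; exact: gh.
Qed.

(** Right translation by h commutes with I, so it commutes with taking the
fundamental form, the exterior derivative and the components of given type. *)
Lemma skt_pull_rtrans g h : (forall x, I x *m dmap (rtrans h) x = dmap (rtrans h) x *m I (x * h)%g) ->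
  inv_hermitian g -> skt I g -> skt I (pull (rtrans h) g).
Proof.
move=> Ih ng /sktP sg; apply/sktP => x v; have [bg _ _ _] := ng.
rewrite fund_form_pull // cform2_of_pull; last exact: bilin_fund_form.
rewrite ddbar_form_pull //; [|exact: smooth_rtrans|exact: smooth_alt_fund_form].
exact: sg.
Qed.

Definition tensor_lin (a : R) (g g' : tensor2 G) : tensor2 G := fun x u v => a * g x u v + g' x u v.

Lemma inv_hermitian_lin a g g' : inv_hermitian g -> inv_hermitian g' -> inv_hermitian (tensor_lin a g g').
Proof.
move=> [[gl gr] lg gs gh] [[gl' gr'] lg' gs' gh']; split.
- by split=> x b u u' v; rewrite /tensor_lin ?gl ?gl' ?gr ?gr'; ring.
- move=> b x; apply/funext => u; apply/funext => v.
  exact: (congr2 (fun s t => a * s + t) (congr1 (fun F => F u v) (lg b x))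
    (congr1 (fun F => F u v) (lg' b x))).
- by move=> x u v; rewrite /tensor_lin gs gs'.
- by move=> x u v; rewrite /tensor_lin gh gh'.
Qed.

Lemma skt_lin a g g' : inv_hermitian g -> inv_hermitian g' -> skt I g -> skt I g' -> skt I (tensor_lin a g g').
Proof.
move=> ng ng' /sktP sg /sktP sg'; apply/sktP => x v.
have -> : cform2_of (fund_form (tensor_lin a g g')) = form_lin a%:C%C (cform2_of (fund_form g)) (cform2_of (fund_form g')).
  apply/funext => y; apply/funext => w; rewrite /form_lin /cform2_of mulr_sumr -big_split.
  apply: eq_bigr => i _ /=; rewrite mulr_sumr -big_split; apply: eq_bigr => j _ /=.
  by rewrite /fund_form /fundamental_form /tensor_lin rmorphD rmorphM; ring.
rewrite ddbar_form_lin; [|exact: smooth_alt_fund_form|exact: smooth_alt_fund_form].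
by rewrite /form_lin sg sg' mulr0 addr0.
Qed.

Definition tensor0 : tensor2 G := fun x u v => 0.

Lemma inv_hermitian0 : inv_hermitian tensor0.
Proof. by split=> //; split=> x a u u' v; rewrite /tensor0 mulr0 addr0. Qed.

Lemma skt0 : skt I tensor0.
Proof.
apply/sktP => x v; have G0 := smooth_alt_fund_form inv_hermitian0.
have Z : cform2_of (fund_form tensor0) = form_lin (-1) (cform2_of (fund_form tensor0)) (cform2_of (fund_form tensor0)).
  by apply/funext => y; apply/funext => w; rewrite /form_lin mulN1r addNr /cform2_of;
    apply: big1 => i _; apply: big1 => j _; rewrite /fund_form /fundamental_form /tensor0 mulr0.
by rewrite Z ddbar_form_lin // /form_lin mulN1r addNr.
Qed.

End FundamentalForm.

(** * Integration over the torus *)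

Section TorusMeasure.
Context (R : realType) (n : nat) (G : lieGroupType R n).
Implicit Types (a h : G).

(** The torus is the image of the unit cube: theta is periodic under integral
vectors. *)
Lemma torus_compact k (T : set G) : torus k T -> compact T.
Proof.
move=> [theta [[ct _] tD t1 <-]].
pose box : set 'rV[R]_k := [set v | forall i, `[0, 1]%classic (v ord0 i)].
have cbox : compact box by apply: (@rV_compact R k (fun=> `[0, 1]%classic)) => i; exact: segment_compact.
have -> : range theta = theta @` box.
  apply/seteqP; split=> [_ [s _ <-]|_ [s _ <-]]; last by exists s.
  pose z : 'rV[R]_k := \row_j (Num.floor (s 0 j))%:~R.
  exists (s - z).
    move=> i; rewrite /= in_itv /= !mxE subr_ge0 floor_le_tmp /=.
    by rewrite lerBlDl ltW // -intrD1 floorD1_gt.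
  have tz : theta z = 1%g by apply/t1 => j; rewrite mxE intr_int.
  by have := tD (s - z) z; rewrite subrK tz mulg1.
apply: continuous_compact => //; exact: continuous_subspaceT.
Qed.

Lemma torus_group k (T : set G) : torus k T ->
  [/\ T 1%g, forall a h, T a -> T h -> T (a * h)%g & forall a, T a -> T a^-1%g].
Proof.
move=> [theta [_ tD t1 <-]].
have t0 : theta 0 = 1%g by apply/t1 => j; rewrite mxE.
split.
- by exists 0.
- by move=> _ _ [s _ <-] [s' _ <-]; exists (s + s').
- move=> _ [s _ <-]; exists (- s) => //.
  by apply: (mulgI (theta s)); rewrite -tD subrr mulgV.
Qed.

Lemma torus_measurable k (T : set G) : torus k T -> measurable (T : set (borel G)).
Proof.
move=> tT; have cT : closed T.
  by apply: compact_closed (torus_compact tT); exact: lie_hausdorff.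
rewrite -[T]setCK; apply: measurableC; apply: sub_sigma_algebra.
exact: closed_openC.
Qed.

Lemma borel_measurable_fun (f : G -> R) : continuous f ->
  measurable_fun [set: borel G] (f : borel G -> R).
Proof.
move=> cf; apply: (measurability _ (RGenOpens.measurableE R)).
move=> _ [_ [a [b ->] <-]]; rewrite setTI; apply: sub_sigma_algebra.
by apply: open_comp => [x _|]; [exact: cf | exact: interval_open].
Qed.

Lemma borel_measurable_map (f : G -> G) : continuous f ->
  measurable_fun [set: borel G] (f : borel G -> borel G).
Proof.
move=> cf; apply: (@measurability _ _ (borel G) (borel G) _ _ (@open G) erefl).
move=> _ [A oA <-]; rewrite setTI; apply: sub_sigma_algebra.
by apply: open_comp => // x _; exact: cf.
Qed.

Context (k : nat) (T : set G) (nu : {measure set (borel G) -> \bar R}).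
Hypothesis hT : torus k T.
Hypothesis hnu : invariant_volume T nu.

Lemma torus_integrable (f : G -> R) : continuous f ->
  nu.-integrable (T : set (borel G)) (EFin \o f).
Proof.
move=> cf; have [_ fin _] := hnu; have mT := torus_measurable hT.
apply: measurable_bounded_integrable => //.
  exact: measurable_funTS (borel_measurable_fun cf).
have cT : {within T, continuous f} by exact: continuous_subspaceT.
have /compact_bounded[M [_ mrt]] := @continuous_compact _ R^o f T cT (torus_compact hT).
by exists M; split; rewrite ?num_real // => N MN x Tx; apply: (mrt N MN); exists x.
Qed.

Lemma torus_integral_sum (I : Type) (s : seq I) (f : I -> G -> R) :
  (forall i, continuous (f i)) ->
  \int[nu]_(h in T) (\sum_(i <- s) f i h) = \sum_(i <- s) \int[nu]_(h in T) f i h.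
Proof.
move=> cf; have mT := torus_measurable hT.
have cs (s' : seq I) : continuous (fun h => \sum_(i <- s') f i h : R).
  move=> h; apply: cvg_big => [|i _]; [exact: add_continuous | exact: cf].
elim: s => [|i s IH].
  under eq_Rintegral do rewrite big_nil.
  by rewrite big_nil Rintegral_cst // mul0r.
under eq_Rintegral do rewrite big_cons.
by rewrite big_cons -IH RintegralD //; exact: torus_integrable.
Qed.

Lemma torus_integralZr (f : G -> R) r : continuous f ->
  \int[nu]_(h in T) (f h * r) = (\int[nu]_(h in T) f h) * r.
Proof.
by move=> cf; rewrite RintegralZr //; [exact: torus_measurable hT | exact: torus_integrable].
Qed.

(** The integrand has a positive minimum on the compact torus. *)
Lemma torus_integral_gt0 (f : G -> R) : continuous f -> (forall h, T h -> 0 < f h) ->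
  0 < \int[nu]_(h in T) f h.
Proof.
move=> cf f0; have [nu0 fin _] := hnu; have mT := torus_measurable hT.
have [T1 _ _] := torus_group hT.
have cT : {within T, continuous f} by exact: continuous_subspaceT.
have [m /set_mem Tm Hm] := compact_EVT_min (ex_intro _ _ T1) (torus_compact hT) cT.
apply: (@lt_le_trans _ _ (\int[nu]_(h in T) f m)).
  rewrite Rintegral_cst // mulr_gt0 ?f0 //.
  by apply: fine_gt0; rewrite nu0 fin.
apply: le_Rintegral => //.
- by apply: torus_integrable; exact: cst_continuous.
- exact: torus_integrable.
- by move=> x Tx; apply: Hm; exact: mem_set.
Qed.

(** The image of nu under translation by a agrees with nu on the subsets of T,
which is all that the integral over T sees. *)
Lemma torus_integral_ltrans (f : G -> R) a : continuous f -> T a ->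
  \int[nu]_(h in T) f (a * h)%g = \int[nu]_(h in T) f h.
Proof.
move=> cf Ta; have [_ _ inv] := hnu; have mT := torus_measurable hT.
have [_ TM TV] := torus_group hT.
have cl : continuous (ltrans a) by exact: mulg_continuous.
have ml := borel_measurable_map cl.
have ET : (ltrans a : borel G -> borel G) @^-1` T = T.
  apply/seteqP; split=> h /= Th; last exact: TM.
  have -> : h = (a^-1 * ltrans a h)%g by rewrite /ltrans mulgA mulVg mul1g.
  by apply: TM => //; exact: TV.
rewrite /Rintegral; congr fine.
have E1 := @integral_pushforward _ _ (borel G) (borel G) R (ltrans a) ml nu T (EFin \o f).
rewrite ET in E1.
have cfl : continuous (f \o ltrans a).
  by move=> x; exact: (continuous_comp (cl x) (cf _)).
have mf : measurable_fun [set: borel G] (EFin \o f).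
  by apply/measurable_EFinP; exact: borel_measurable_fun.
rewrite -(E1 mf (torus_integrable cfl) mT).
by apply: eq_measure_integral => A mA AT; exact: (inv a A Ta mA AT).
Qed.

End TorusMeasure.

(** * The average as a finite linear combination *)

Section FiniteCombination.
Context (R : realType).

Lemma nth_In (X : Type) (x0 : X) (s : seq X) i : (i < size s)%N -> List.In (nth x0 s i) s.
Proof. by elim: s i => // x s IH [|i] /= Hi; [left | right; exact: IH]. Qed.

(** Elements that enlarge the span are added until none is left; the dimension
bounds the number of steps. *)
Lemma finite_spanning (K : fieldType) (vT : vectType K) (X : Type) (T : set X) (B : X -> vT) :
  exists s : seq X, (forall h, List.In h s -> T h) /\ forall h, T h -> B h \in <<map B s>>%VS.
Proof.
suff H m : forall s, (forall h, List.In h s -> T h) ->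
    (\dim {:vT} - \dim <<map B s>> <= m)%N ->
    exists s : seq X, (forall h, List.In h s -> T h) /\ forall h, T h -> B h \in <<map B s>>%VS.
  by apply: (H _ [::]).
elim: m => [|m IH] s Ts dm.
  exists s; split=> // h _; have -> : <<map B s>>%VS = fullv.
    apply/eqP; rewrite eqEdim subvf /=.
    by move: dm; rewrite leqn0 subn_eq0.
  exact: memvf.
have [Hs|] := pselect (forall h, T h -> B h \in <<map B s>>%VS); first by exists s.
move=> /existsNP[h /not_implyP[Th /negP Bh]].
apply: (IH (h :: s)) => [h' [<-|]//|]; first exact: Ts.
have lt : (\dim <<map B s>> < \dim <<map B (h :: s)>>)%N.
  have sub : (<<map B s>> <= <<map B (h :: s)>>)%VS by rewrite /= span_cons addvSr.
  have [le eq] := dimv_leqif_eq sub.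
  rewrite ltn_neqAle le andbT eq; apply: contra Bh => /eqP ->.
  by apply: memv_span; rewrite inE eqxx.
have := dimvS (subvf <<map B (h :: s)>>); move: dm lt.
by lia.
Qed.

End FiniteCombination.

Section Symmetrization.
Context (R : realType) (n : nat) (G : lieGroupType R n).
Context (k : nat) (T : set G) (nu : {measure set (borel G) -> \bar R}).
Hypothesis hT : torus k T.
Hypothesis hnu : invariant_volume T nu.
Implicit Types (a h : G).

(** The Gram matrix at 1 of the pull-back of g under right translation by h. *)
Definition rtrans_gram (g : tensor2 G) h : 'M[R]_n := Ad_mx h^-1%g *m gram g *m (Ad_mx h^-1%g)^T.

Lemma pull_rtrans_gram g h x (u v : 'rV[R]_n) : bilin g -> linv g ->
  pull (rtrans h) g x u v
  = (u *m invmx (dmap (ltrans x) 1%g) *m rtrans_gram g h *m (v *m invmx (dmap (ltrans x) 1%g))^T) 0 0.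
Proof.
move=> bg lg; rewrite (linv_base _ _ _ (linv_pull_rtrans h lg)) pull_rtrans1 //.
by rewrite gramE // trmx_mul /rtrans_gram !mulmxA.
Qed.

Lemma rtrans_gram_continuous g i j : continuous (fun h => rtrans_gram g h i j : R).
Proof.
have CI i' j' : continuous (fun h : G => Ad_mx h^-1%g i' j' : R).
  move=> h; exact: (continuous_comp (lie_inv_cont (s := G) h) (@Ad_mx_continuous _ _ _ i' j' _)).
have E : (fun h => rtrans_gram g h i j : R) = (fun h => \sum_l (\sum_m Ad_mx h^-1%g i m * gram g m l) * Ad_mx h^-1%g j l).
  apply/funext => h; rewrite /rtrans_gram mxE; apply: eq_bigr => l _.
  by rewrite !mxE.
rewrite E => h; apply: cvg_big => [|l _]; first exact: add_continuous.
apply: cvgM; last exact: CI.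
apply: cvg_big => [|m _]; first exact: add_continuous.
by apply: cvgM; [exact: CI | exact: cvg_cst].
Qed.

Lemma linear_rtrans_gram_continuous g (L : {scalar 'M[R]_n}) : continuous (fun h => L (rtrans_gram g h) : R).
Proof.
have E : (fun h => L (rtrans_gram g h) : R) = (fun h => \sum_i \sum_j rtrans_gram g h i j * L (delta_mx i j)).
  apply/funext => h; rewrite {1}(matrix_sum_delta (rtrans_gram g h)) linear_sum.
  apply: eq_bigr => i _; rewrite linear_sum; apply: eq_bigr => j _.
  by rewrite linearZ.
rewrite E => h; apply: cvg_big => [|i _]; first exact: add_continuous.
apply: cvg_big => [|j _]; first exact: add_continuous.
by apply: cvgM; [exact: rtrans_gram_continuous | exact: cvg_cst].
Qed.

Lemma pull_continuous g x u v : bilin g -> linv g ->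
  continuous (fun h => pull (rtrans h) g x u v : R).
Proof.
move=> bg lg.
set p := u *m invmx (dmap (ltrans x) 1%g); set q := v *m invmx (dmap (ltrans x) 1%g).
have E : (fun h => pull (rtrans h) g x u v : R)
   = (fun h => \sum_j (\sum_i p 0 i * rtrans_gram g h i j) * q 0 j).
  apply/funext => h; rewrite pull_rtrans_gram // -/p -/q mxE.
  by apply: eq_bigr => j _; rewrite !mxE.
rewrite E => h; apply: cvg_big => [|j _]; first exact: add_continuous.
apply: cvgM; last exact: cvg_cst.
apply: cvg_big => [|i _]; first exact: add_continuous.
by apply: cvgM; [exact: cvg_cst | exact: rtrans_gram_continuous].
Qed.

Definition rtrans_comb (s : seq (R * G)) (g : tensor2 G) : tensor2 G :=
  foldr (fun p g' => tensor_lin p.1 (pull (rtrans p.2) g) g') (@tensor0 R n G) s.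

Lemma rtrans_combE s g x u v :
  rtrans_comb s g x u v = \sum_(p <- s) p.1 * pull (rtrans p.2) g x u v.
Proof. by elim: s => [|p s IH] /=; rewrite ?big_nil // big_cons -IH. Qed.

Lemma symmetrizationE g x u v :
  symmetrization T nu g x u v = \int[nu]_(h in T) pull (rtrans h) g x u v.
Proof. by rewrite /symmetrization pullE. Qed.

(** The Gram matrices of the pull-backs of g span a finite-dimensional space, so
each is a combination of finitely many of them, with coefficients that depend
linearly, hence continuously, on the matrix. Integrating the coefficients
gives the average as a combination of the same pull-backs. *)
Lemma symmetrization_rtrans_comb g : bilin g -> linv g ->
  exists2 s : seq (R * G), forall p, List.In p s -> T p.2 & symmetrization T nu g = rtrans_comb s g.
Proof.
move=> bg lg; have [hs [Ths Hs]] := finite_spanning T (rtrans_gram g).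
set X := in_tuple (map (rtrans_gram g) hs).
have E h : T h -> rtrans_gram g h = \sum_i coord X i (rtrans_gram g h) *: X`_i.
  by move=> /Hs Bh; exact: coord_span.
pose hi (i : 'I_(size (map (rtrans_gram g) hs))) := nth 1%g hs i.
have Xi (i : 'I_(size (map (rtrans_gram g) hs))) : X`_i = rtrans_gram g (hi i).
  by rewrite /X /= (nth_map 1%g) // -(size_map (rtrans_gram g) hs).
pose ci i : R := \int[nu]_(h in T) coord X i (rtrans_gram g h).
exists [seq (ci i, hi i) | i <- enum 'I_(size (map (rtrans_gram g) hs))].
  move=> p; rewrite List.in_map_iff => -[i [<- _]] /=; apply: Ths.
  by apply: nth_In; have := ltn_ord i; rewrite {2}size_map.
apply/funext => x; apply/funext => u; apply/funext => v.
rewrite symmetrizationE rtrans_combE big_map big_enum /=.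
have P h : T h -> pull (rtrans h) g x u v
    = \sum_i coord X i (rtrans_gram g h) * pull (rtrans (hi i)) g x u v.
  move=> Th; rewrite pull_rtrans_gram // {1}(E h Th) mulmx_sumr mulmx_suml summxE.
  apply: eq_bigr => i _; rewrite pull_rtrans_gram // -Xi.
  by rewrite -scalemxAr -scalemxAl mxE.
have -> : \int[nu]_(h in T) pull (rtrans h) g x u v
    = \int[nu]_(h in T) \sum_i coord X i (rtrans_gram g h) * pull (rtrans (hi i)) g x u v.
  by apply: eq_Rintegral => h /set_mem; exact: P.
rewrite (torus_integral_sum hT hnu); last first.
  move=> i h; apply: cvgM; last exact: cvg_cst.
  exact: (@linear_rtrans_gram_continuous g (coord X i)).
apply: eq_bigr => i _; rewrite (torus_integralZr hT hnu) //.
exact: (@linear_rtrans_gram_continuous g (coord X i)).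
Qed.

End Symmetrization.

(** * The symmetrized metric *)

Section Combination.
Context (R : realType) (n : nat) (G : lieGroupType R n).
Context (I : G -> 'M[R]_n).
Hypothesis HI : linv_endo I.
Hypothesis I2 : I 1%g *m I 1%g = - 1%:M.

Lemma inv_hermitian_rtrans_comb (T : set G) (s : seq (R * G)) (g : tensor2 G) :
  (forall h, T h -> forall x, I x *m dmap (rtrans h) x = dmap (rtrans h) x *m I (x * h)%g) ->
  (forall p, List.In p s -> T p.2) -> inv_hermitian I g -> skt I g ->
  inv_hermitian I (rtrans_comb s g) /\ skt I (rtrans_comb s g).
Proof.
move=> IT + ng sg; elim: s => [_|p s IH Ts] /=.
  by split; [exact: inv_hermitian0 | exact: skt0].
have [n1 s1] := IH (fun q Hq => Ts q (or_intror Hq)).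
have Ip := IT _ (Ts p (or_introl erefl)).
have n2 := inv_hermitian_pull_rtrans Ip ng.
have s2 := skt_pull_rtrans HI I2 Ip ng sg.
by split; [exact: inv_hermitian_lin | exact: skt_lin].
Qed.

End Combination.

Lemma symmetrization_rinv (R : realType) (n : nat) (G : lieGroupType R n)
  (k : nat) (T : set G) (nu : {measure set (borel G) -> \bar R}) (g : tensor2 G) :
  torus k T -> invariant_volume T nu -> bilin g -> linv g ->
  right_invariant T (symmetrization T nu g).
Proof.
move=> hT hnu bg lg a Ta x u v; rewrite pullE /pull !symmetrizationE.
rewrite -(torus_integral_ltrans hT hnu (@pull_continuous _ _ _ g x u v bg lg) Ta).
apply: eq_Rintegral => h _.
rewrite /pull -!mulmxA -(dmap_rtransM h (erefl (x * a)%g)).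
by rewrite /rtrans mulgA.
Qed.

Lemma symmetrization_gt0 (R : realType) (n : nat) (G : lieGroupType R n)
  (k : nat) (T : set G) (nu : {measure set (borel G) -> \bar R}) (g : tensor2 G) x u :
  torus k T -> invariant_volume T nu -> bilin g -> linv g ->
  (forall x u, u != 0 -> 0 < g x u u) -> u != 0 -> 0 < symmetrization T nu g x u u.
Proof.
move=> hT hnu bg lg gp u0; rewrite symmetrizationE.
apply: (torus_integral_gt0 hT hnu (@pull_continuous _ _ _ g x u u bg lg)) => h _.
apply: gp; apply: contra u0 => /eqP E.
by rewrite -(mulmxK (unit_rtrans h x) u) E mul0mx.
Qed.

Theorem lemma3p1 (R : realType) (n : nat) (G : lieGroupType R n)
  (hcompact : compact [set: G]) (hsemisimple : semisimple_group G)
  (r : nat) (T : set G) (hT : maximal_torus r T) (hr : ~~ odd r)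
  (t : {vspace 'rV[R]_n}) (ht : forall X, X \in t <-> lie_of T X)
  (Phi P : seq (functional t))
  (hPhi : root_space_decomposition G Phi) (hP : positive_system Phi P)
  (J : 'End(subvs_of t)) (hJ : forall X, J (J X) = - X)
  (I : G -> 'M[R]_n) (hI : samelson P J I)
  (nu : {measure set (borel G) -> \bar R}) (hnu : invariant_volume T nu)
  (g : tensor2 G) (hg : riemannian g) (hgI : hermitian_metric I g) (hskt : skt I g)
  (hleft : left_invariant g) :
  let gbar := symmetrization T nu g in
  [/\ riemannian gbar, hermitian_metric I gbar, skt I gbar,
      left_invariant gbar & right_invariant T gbar].
Proof.
have [tT _] := hT; have [_ _ TV] := torus_group tT.
have [gl gs gp _] := hg.
have HI : linv_endo I by apply: linv_endoP; case: hI.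
have I2 := samelson_square1 hPhi hP hJ hI.
have IT h : T h -> forall x, I x *m dmap (rtrans h) x = dmap (rtrans h) x *m I (x * h)%g.
  move=> Th x; apply: endo_rtrans => //.
  exact: (samelson_Ad_mx tT ht hPhi hP hJ hI (TV h Th)).
have bg : bilin g by split=> // x a u u' v; rewrite gs gl !(gs x v).
have lg : linv g.
  by move=> a x; apply/funext => u; apply/funext => v; have := hleft a x u v; rewrite pullE.
have ng : inv_hermitian I g by [].
have [s Ts E] := symmetrization_rtrans_comb tT hnu bg lg.
have [[bb lb sb hb] skb] := inv_hermitian_rtrans_comb HI I2 IT Ts ng hskt.
split.
- rewrite E; split=> [||x u u0|]; [exact: bb.1|exact: sb| |exact: linv_smooth].
  by rewrite -E; exact: symmetrization_gt0 tT hnu bg lg gp u0.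
- by rewrite E.
- by rewrite E.
- by rewrite E => a x u v; rewrite pullE lb.
- exact: symmetrization_rinv tT hnu bg lg.
Qed.
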